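(* Every neighborly cubical $4$-polytope satisfies $$f_3=\frac{f_0}{4}\log_2\frac{f_0}{4},$$ that is, it has $f_3=(n-2)2^{n-2}$ facets if it has $f_0=2^n$ vertices. Consequently the facet-vertex ratio $f_3/f_0$ is not bounded on the class of cubical $4$-polytopes.
   Context: A combinatorial cube is a polytope combinatorially equivalent to $[0,1]^k$ for some $k$; a cubical polytope is a convex polytope all of whose proper faces are combinatorial cubes. A neighborly cubical $d$-polytope is a cubical $d$-polytope with $2^n$ vertices, for some $n\ge d$, whose $(\lfloor d/2\rfloor-1)$-skeleton is combinatorially equivalent to that of the $n$-cube; for $d=4$ this means a cubical $4$-polytope whose graph is isomorphic to the graph of the $n$-cube for some $n\ge4$. $f_i$ is the number of $i$-dimensional faces. *)

(* Defs.v *)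
From HB Require Import structures.
From mathcomp Require Import all_boot all_order all_algebra.
From mathcomp Require Import finmap.
From mathcomp Require Import boolp classical_sets functions cardinality reals.
From mathcomp Require Import sequences exp.

Set Implicit Arguments.
Unset Strict Implicit.
Unset Printing Implicit Defensive.

Import Order.TTheory GRing.Theory Num.Theory.

Local Open Scope classical_set_scope.
Local Open Scope ring_scope.

Section Polytopes.
Context {R : realType}.

Definition conv_hull m N (v : 'I_N -> 'rV[R]_m) : set 'rV[R]_m :=
  [set x | exists w : 'I_N -> R,
     [/\ forall i, 0 <= w i, \sum_(i < N) w i = 1
       & x = \sum_(i < N) w i *: v i]].

Definition is_polytope m (P : set 'rV[R]_m) : Prop :=
  exists N (v : 'I_N -> 'rV[R]_m), P = conv_hull v.

(* [x0] and the points [x0 + row i B] are k+1 affinely independent points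
   of A, and their affine hull contains A. No k works when A is empty. *)
Definition has_dim m (A : set 'rV[R]_m) (k : nat) : Prop :=
  exists (x0 : 'rV[R]_m) (B : 'M[R]_(k, m)),
    [/\ A x0, row_free B, forall i, A (x0 + row i B)
      & forall x, A x -> (x - x0 <= B)%MS].

(* Taking c = 0, both P itself and the empty set are faces of P. *)
Definition faces m (P : set 'rV[R]_m) : set (set 'rV[R]_m) :=
  [set F | exists (c : 'cV[R]_m) (b : R),
     (forall x, P x -> (x *m c) 0 0 <= b) /\
     F = [set x | P x /\ (x *m c) 0 0 = b]].

(* A polytope has finitely many faces, so the junk value 0 that [fset_set]
   gives on infinite sets does not occur there. *)
Definition face_num m (i : nat) (P : set 'rV[R]_m) : nat :=
  #|` fset_set [set F | faces P F /\ has_dim F i]|.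

(* Isomorphism of families of sets ordered by inclusion. *)
Definition comb_equiv (U V : Type) (X : set (set U)) (Y : set (set V)) : Prop :=
  exists phi : set U -> set V,
    set_bij X Y phi /\
    forall F G, X F -> X G -> (F `<=` G <-> phi F `<=` phi G).

Definition cube k : set 'rV[R]_k := [set x | forall i, 0 <= x 0 i <= 1].

Definition comb_cube m (P : set 'rV[R]_m) : Prop :=
  is_polytope P /\ exists k, comb_equiv (faces P) (faces (@cube k)).

(* The empty face is not counted among the proper faces here: it is not a
   combinatorial cube. *)
Definition cubical_polytope m (d : nat) (P : set 'rV[R]_m) : Prop :=
  [/\ is_polytope P, has_dim P d
    & forall F, faces P F -> F !=set0 -> F <> P -> comb_cube F].

(* The empty set belongs to every skeleton. *)
Definition skeleton m (k : nat) (P : set 'rV[R]_m) : set (set 'rV[R]_m) :=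
  [set F | faces P F /\ (F = set0 \/ exists2 i, (i <= k)%N & has_dim F i)].

(* For d < 2 the index d./2.-1 is 0 instead of -1, which is harmless: the
   number of vertices already determines the 0-skeleton. *)
Definition neighborly_cubical m (d : nat) (P : set 'rV[R]_m) : Prop :=
  cubical_polytope d P /\
  exists n, [/\ (d <= n)%N, face_num 0 P = (2 ^ n)%N
    & comb_equiv (skeleton d./2.-1 P) (skeleton d./2.-1 (@cube n))].

End Polytopes.

Definition log2 (R : realType) (x : R) : R := ln x / ln 2.

(* Main.v *)
(** Faces of a polytope [hull v] are encoded by the index sets [T] on which some
    valid functional is tight.  The slack vectors of valid functionals are the
    nonnegative vectors of the row space [L] of [slacks v], and [T] is the zero
    set of one of them, so the face lattice is read off the cone of nonnegative
    vectors of [L]: the face [T] has codimension the rank of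
    [face_space L T].  The Euler relation is proved for such cones, by
    induction on the rank, sweeping with a generic functional.  Applied to the
    whole cone it gives [f0 - f1 + f2 - f3 = 0]; applied to a face of rank 2 it
    says that a ridge lies in exactly two facets.  As every facet of a cubical
    4-polytope has six 2-faces, [2 f3 = f1 - f0], and neighborliness gives
    [f1 = n 2^(n-1)].

    For the unboundedness we project a deformed [n]-cube
    [{x | forall k, +- e x_k + sum_(j < k) M_kj x_j <= b_k}] to its last four
    coordinates, in the spirit of Joswig and Ziegler.  Column [j] of [M] is the
    third difference operator placed just below the diagonal, so a functional of
    the projection corresponds to multipliers [l] solving
    [+- e l_j + (third difference of l at j + 1) = 0]; for small [e] these are
    perturbed quadratic polynomials.  The perturbations of [(k - i)^2] show that
    every edge of the cube survives, and the fact that a nonzero solution has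
    at most three zeros shows that all proper faces are cubes. *)
Require Import Defs.
From mathcomp Require Import all_boot all_order all_algebra.
From mathcomp Require Import finmap polyrcf.
From mathcomp Require Import boolp classical_sets functions cardinality reals.
From mathcomp Require Import sequences exp.
From mathcomp Require Import ring lra zify.

Set Implicit Arguments.
Unset Strict Implicit.
Unset Printing Implicit Defensive.

Import Order.TTheory GRing.Theory Num.Theory.

Local Open Scope classical_set_scope.
Local Open Scope ring_scope.

(** * Cones of nonnegative vectors in a linear subspace *)

Section Cones.
Context {R : realFieldType}.

Definition zset N (z : 'rV[R]_N) : {set 'I_N} := [set i | z 0 i == 0].

Definition mask N (S : {set 'I_N}) : 'M[R]_N := diag_mx (\row_i (i \in S)%:R).

(** If some nonnegative vector of [L] has zero set exactly [S], this is the linear span of the face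
    of the cone cut out by [S], and its rank is the dimension of that face as a cone. *)
Definition face_space p N (L : 'M[R]_(p, N)) (S : {set 'I_N}) : 'M[R]_N :=
  (L :&: kermx (mask S))%MS.

Definition dot p (l : 'cV[R]_p) (z : 'rV[R]_p) : R := (z *m l) 0 0.

Definition mass N (z : 'rV[R]_N) : R := dot (const_mx 1) z.

(** Normalizing the mass to 1 replaces the cone by a bounded base and excludes the zero vector. *)
Definition base_point p N (L : 'M[R]_(p, N)) (z : 'rV[R]_N) : Prop :=
  [/\ (z <= L)%MS, forall i, 0 <= z 0 i & mass z = 1].

Definition realized p N (L : 'M[R]_(p, N)) (J : {set 'I_N}) : bool :=
  `[< exists2 z, base_point L z & zset z = J >].

Lemma dotD p (l : 'cV[R]_p) x y : dot l (x + y) = dot l x + dot l y.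
Proof. by rewrite /dot mulmxDl mxE. Qed.

Lemma dotZ p (l : 'cV[R]_p) a x : dot l (a *: x) = a * dot l x.
Proof. by rewrite /dot -scalemxAl mxE. Qed.

Lemma dotN p (l : 'cV[R]_p) x : dot l (- x) = - dot l x.
Proof. by rewrite -scaleN1r dotZ mulN1r. Qed.

Lemma dotNl p (l : 'cV[R]_p) x : dot (- l) x = - dot l x.
Proof. by rewrite /dot mulmxN mxE. Qed.

Lemma massE N (z : 'rV[R]_N) : mass z = \sum_i z 0 i.
Proof. by rewrite /mass /dot mxE; apply: eq_bigr => i _; rewrite mxE mulr1. Qed.

Lemma in_zset N (z : 'rV[R]_N) i : (i \in zset z) = (z 0 i == 0).
Proof. by rewrite inE. Qed.

Lemma sub_face_space p N (L : 'M[R]_(p, N)) S (z : 'rV[R]_N) :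
  (z <= face_space L S)%MS = (z <= L)%MS && (S \subset zset z).
Proof.
rewrite sub_capmx; congr (_ && _); apply/sub_kermxP/fintype.subsetP => [H i iS | H].
  rewrite in_zset; move/matrixP: H => /(_ 0 i).
  by rewrite mul_mx_diag !mxE iS mulr1 => ->.
apply/rowP => i; rewrite mul_mx_diag !mxE.
by have [/H|] := boolP (i \in S); rewrite ?mulr0 // in_zset => /eqP ->; rewrite mul0r.
Qed.

Lemma rank_face_space p N (L : 'M[R]_(p, N)) S :
  (\rank (L *m mask S) + \rank (face_space L S) = \rank L)%N.
Proof. exact: mxrank_mul_ker. Qed.

Lemma rank_face_set0 p N (L : 'M[R]_(p, N)) :
  \rank (face_space L finset.set0) = \rank L.
Proof.
have := rank_face_space L finset.set0.
suff -> : mask finset.set0 = 0 :> 'M[R]_N by rewrite mulmx0 mxrank0.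
by apply/matrixP => i j; rewrite !mxE inE mul0rn.
Qed.

(** A mass-zero direction on which [l] does not vanish makes [l] nonconstant on the mass-one part of
    the space. *)
Definition generic p N (L : 'M[R]_(p, N)) (l : 'cV[R]_N) : Prop :=
  forall S, (2 <= \rank (face_space L S))%N ->
  exists u, [/\ (u <= face_space L S)%MS, mass u = 0 & dot l u != 0].

Lemma genericN p N (L : 'M[R]_(p, N)) l : generic L l -> generic L (- l).
Proof. by move=> H S /H [u [? ? ?]]; exists u; split=> //; rewrite dotNl oppr_eq0. Qed.

Lemma poly_nonroot (p : {poly R}) : p != 0 -> exists x, p.[x] != 0.
Proof.
move=> p0; apply/not_existsP => H.
pose s := [seq (k%:R : R) | k <- iota 0 (size p)].
have : (size s < size p)%N.
  apply: max_poly_roots => //.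
    by apply/allP => x _; apply/negPn/negP => /H.
  by rewrite map_inj_uniq ?iota_uniq // => i j /eqP; rewrite eqr_nat => /eqP.
by rewrite size_map size_iota ltnn.
Qed.

(** The functional is taken on the moment curve [(1, x, x^2, ...)]: its value on [u i] is that of a
    nonzero polynomial at [x], and the product of these polynomials has a nonroot. *)
Lemma avoid_hyperplanes (I : finType) N (u : I -> 'rV[R]_N) :
  (forall i, u i != 0) -> exists l : 'cV[R]_N, forall i, dot l (u i) != 0.
Proof.
move=> u0; pose p := \prod_i rVpoly (u i).
have p0 : p != 0.
  apply/prodf_neq0 => i _; apply: contraNneq (u0 i) => H.
  by rewrite -[u i]rVpolyK H linear0.
have [x] := poly_nonroot p0.
rewrite horner_prod => /prodf_neq0 H; exists (\col_i x ^+ i) => i.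
move: (H i isT); rewrite /dot mxE /rVpoly horner_poly.
suff -> : \sum_(j < N) (u i) 0 j * (\col_k x ^+ k : 'cV_N) j 0 =
   \sum_(j < N) (if insub (j : nat) is Some k then u i 0 k else 0) * x ^+ j by [].
by apply: eq_bigr => j _; rewrite mxE valK.
Qed.

(** A space of rank at least 2 contains a nonzero vector of mass zero; one is fixed for each [S],
    and [l] is chosen to vanish on none of them. *)
Lemma exists_generic p N (L : 'M[R]_(p, N)) : exists l, generic L l.
Proof.
pose K S := (face_space L S :&: kermx (const_mx 1 : 'cV[R]_N))%MS.
have K0 S : (2 <= \rank (face_space L S))%N ->
    exists2 u : 'rV[R]_N, (u <= K S)%MS & u != 0.
  move=> r2; apply/rowV0Pn; rewrite -mxrank_eq0 -lt0n.
  have := mxrank_mul_ker (face_space L S) (const_mx 1 : 'cV[R]_N).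
  have := rank_leq_col (face_space L S *m (const_mx 1 : 'cV[R]_N)).
  rewrite -/(K S); move: (\rank _) (\rank (K S)) (\rank (face_space L S)) r2; lia.
pose I := {S : {set 'I_N} | (2 <= \rank (face_space L S))%N}.
have uex (i : I) : exists u : 'rV[R]_N, (u <= K (sval i))%MS /\ u != 0.
  by case: i => S r2; have [u] := K0 S r2; exists u.
have [u uP] := boolp.choice uex.
have [l lP] := @avoid_hyperplanes I N u (fun i => proj2 (uP i)).
exists l => S r2; pose i : I := exist _ S r2; exists (u i); split; last exact: lP.
  by have [H _] := uP i; apply: submx_trans H (capmxSl _ _).
have [H _] := uP i; rewrite /mass /dot.
by have /sub_kermxP -> := submx_trans H (capmxSr _ _); rewrite mxE.
Qed.


Lemma base_point_neq0 p N (L : 'M[R]_(p, N)) z : base_point L z -> z != 0.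
Proof.
case=> _ _ m1; apply/eqP => z0; move/eqP: m1.
by rewrite z0 /mass /dot mul0mx mxE eq_sym oner_eq0.
Qed.

Lemma base_point_face p N (L : 'M[R]_(p, N)) z (S : {set 'I_N}) :
  base_point L z -> S \subset zset z -> (z <= face_space L S)%MS.
Proof. by case=> zL _ _ Sz; rewrite sub_face_space zL. Qed.

Lemma rank_base_point p N (L : 'M[R]_(p, N)) z :
  base_point L z -> (0 < \rank (face_space L (zset z)))%N.
Proof.
move=> bz; rewrite lt0n mxrank_eq0; apply: contraNneq (base_point_neq0 bz) => e.
by have := base_point_face bz (subxx _); rewrite e submx0.
Qed.

Lemma base_point_mix p N (L : 'M[R]_(p, N)) x y a :
  base_point L x -> base_point L y -> 0 < a < 1 ->
  base_point L (a *: x + (1 - a) *: y) /\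
  zset (a *: x + (1 - a) *: y) = zset x :&: zset y.
Proof.
move=> [xL x0 mx] [yL y0 my] /andP[a0 a1].
have b0 : 0 < 1 - a by rewrite subr_gt0.
split; first split.
- by rewrite addmx_sub ?scalemx_sub.
- by move=> i; rewrite !mxE addr_ge0 // mulr_ge0 // ltW.
- by rewrite /mass dotD !dotZ -!/(mass _) mx my; ring.
apply/setP => i; rewrite !inE !mxE paddr_eq0 ?(mulr_ge0 (ltW a0)) ?(mulr_ge0 (ltW b0)) //.
by rewrite !mulf_eq0 (gt_eqF a0) (gt_eqF b0).
Qed.

Lemma face_space_le p N (L : 'M[R]_(p, N)) (S T : {set 'I_N}) :
  S \subset T -> (face_space L T <= face_space L S)%MS.
Proof.
move=> ST; apply/rV_subP => z; rewrite !sub_face_space => /andP[-> /=].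
exact: fintype.subset_trans.
Qed.

(** This is the ratio test of the simplex method: zero mass forces a negative entry of [u], and the
    smallest ratio [z_i / - u_i] over the negative entries is the step at which a new coordinate
    first reaches zero. *)
Lemma push_to_boundary N (z u : 'rV[R]_N) :
  (forall i, 0 <= z 0 i) -> zset z \subset zset u -> mass u = 0 -> u != 0 ->
  exists2 t, 0 < t & (forall i, 0 <= (z + t *: u) 0 i) /\
     zset z \proper zset (z + t *: u).
Proof.
move=> z0 zu mu u0.
have [i0 ui0] : exists i, u 0 i < 0.
  apply/not_existsP => H; move/negP: u0; apply; apply/eqP/rowP => i; rewrite mxE.
  have Hu j : 0 <= u 0 j by rewrite leNgt; apply/negP/H.
  move: mu; rewrite massE => /eqP; rewrite psumr_eq0 // => /allP /(_ i).
  by rewrite mem_index_enum => /(_ isT) /eqP.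
pose f i := z 0 i / - u 0 i.
pose j := [arg min_(i < i0 | u 0 i < 0) f i]%O.
have [uj fj] : u 0 j < 0 /\ forall i, u 0 i < 0 -> f j <= f i.
  by rewrite /j; case: arg_minP.
have zj : 0 < z 0 j.
  rewrite lt_neqAle z0 andbT eq_sym; apply/eqP => e.
  move/fintype.subsetP: zu => /(_ j); rewrite !in_zset e eqxx => /(_ isT) /eqP e'.
  by rewrite e' ltxx in uj.
exists (f j); first by rewrite divr_gt0 // oppr_gt0.
split=> [i|].
  rewrite !mxE; have [ui|ui] := ltP (u 0 i) 0; last first.
    by rewrite addr_ge0 // mulr_ge0 // divr_ge0 // ?ltW // oppr_gt0.
  have := fj i ui; rewrite {2}/f ler_pdivlMr ?oppr_gt0 //; lra.
apply/properP; split.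
  apply/fintype.subsetP => i iz; move/fintype.subsetP: zu => /(_ i iz).
  by move: iz; rewrite !in_zset !mxE => /eqP -> /eqP ->; rewrite mulr0 addr0.
exists j; rewrite in_zset; last by rewrite gt_eqF.
by rewrite !mxE /f; apply/eqP; field; rewrite lt_eqF.
Qed.

(* Moving inside the face along a direction of zero mass with l increasing
   strictly enlarges the zero set, so the ascent ends on an extreme ray. *)
Lemma ascend_to_ray p N (L : 'M[R]_(p, N)) l z : generic L l -> base_point L z ->
  exists r, [/\ base_point L r, zset z \subset zset r,
     \rank (face_space L (zset r)) = 1%N
   & dot l z <= dot l r ?= iff (\rank (face_space L (zset z)) == 1%N)].
Proof.
move=> gl; move: {2}#|~: zset z| (leqnn #|~: zset z|) => k; elim: k z => [|k IH] z.
  rewrite leqn0 cards_eq0 => /eqP e bz; have := base_point_neq0 bz.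
  case/negP; apply/eqP/rowP => i; have /setP /(_ i) := e.
  by rewrite !inE mxE => /negbFE /eqP.
move=> zk bz; have r0 := rank_base_point bz.
have [r1|rn1] := eqVneq (\rank (face_space L (zset z))) 1%N.
  by exists z; split=> //; apply/leif_refl.
have [|u [uL mu lu]] := gl (zset z); first by rewrite ltn_neqAle eq_sym rn1.
wlog lu0 : u uL mu lu / 0 < dot l u.
  move=> H; have [|h|] := ltgtP (dot l u) 0; last by move/eqP; rewrite (negPf lu).
  - move=> h; apply: (H (- u)); rewrite ?eqmx_opp // ?dotN ?oppr_eq0 ?oppr_gt0 //.
    by rewrite /mass dotN -/(mass _) mu oppr0.
  - exact: (H u).
have un0 : u != 0.
  by apply: contraTneq lu0 => ->; rewrite /dot mul0mx mxE ltxx.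
move: uL; rewrite sub_face_space => /andP[uL zu]; have [zL z0 mz] := bz.
have [t t0 [zt0 ztp]] := push_to_boundary z0 zu mu un0.
have bzt : base_point L (z + t *: u).
  split=> //; first by rewrite addmx_sub ?scalemx_sub.
  by rewrite /mass dotD dotZ -!/(mass _) mz mu mulr0 addr0.
have [|r [br zr rr lr]] := IH (z + t *: u) _ bzt.
  rewrite -ltnS; apply: leq_trans zk; apply: proper_card.
  by rewrite properC.
exists r; split=> //; first by apply: fintype.subset_trans zr; apply: proper_sub.
have lt : dot l z < dot l r.
  apply: lt_le_trans (lr.1); rewrite dotD dotZ ltrDl; exact: mulr_gt0.
by split; [exact: ltW | rewrite lt_eqF].
Qed.

End Cones.

(** * The Euler relation for cones, by sweeping with a generic functional *)

Section Euler.
Context {R : realFieldType}.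

(** On vectors of mass 1 the condition [dot l z = t] becomes linear and homogeneous. A slice of the
    base is therefore again the base of a cone, to which an induction on the rank applies. *)
Definition slice p N (L : 'M[R]_(p, N)) (l : 'cV[R]_N) (t : R) : 'M[R]_N :=
  (L :&: kermx (l - t *: const_mx 1))%MS.

Lemma dot_slice N (l : 'cV[R]_N) t z :
  dot (l - t *: const_mx 1) z = dot l z - t * mass z.
Proof. by rewrite /mass /dot mulmxBr -scalemxAr !mxE. Qed.

Lemma base_point_slice p N (L : 'M[R]_(p, N)) l t z :
  base_point (slice L l t) z <-> base_point L z /\ dot l z = t.
Proof.
have E : mass z = 1 -> (z <= kermx (l - t *: const_mx 1))%MS <-> dot l z = t.
  move=> m1; have := dot_slice l t z; rewrite m1 mulr1 => v.
  split=> [/sub_kermxP H|H].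
    by move: v; rewrite {1}/dot H mxE => /eqP; rewrite eq_sym subr_eq0 => /eqP.
  by apply/sub_kermxP/matrixP => i j; rewrite !ord1 [RHS]mxE -/(dot _ z) v H subrr.
split=> [[]|[[zL z0 m1] h]].
  by rewrite sub_capmx => /andP[zL zk] z0 m1; split=> //; apply/E.
by split=> //; rewrite sub_capmx zL; apply/E.
Qed.

Lemma realized_slice p N (L : 'M[R]_(p, N)) l t J :
  reflect (exists z, [/\ base_point L z, dot l z = t & zset z = J])
          (realized (slice L l t) J).
Proof.
apply: (iffP (asboolP _)) => [[z /base_point_slice[bz h] zJ]|[z [bz h zJ]]].
  by exists z.
by exists z => //; apply/base_point_slice.
Qed.

Lemma realizedP p N (L : 'M[R]_(p, N)) J :
  reflect (exists2 z, base_point L z & zset z = J) (realized L J).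
Proof. exact: asboolP. Qed.

Lemma realized_slice_realized p N (L : 'M[R]_(p, N)) l t J :
  realized (slice L l t) J -> realized L J.
Proof. by case/realized_slice => z [bz _ zJ]; apply/realizedP; exists z. Qed.

(** By genericity the slicing hyperplane does not contain a face space of rank at least 2, so its
    rank drops by one. A ray that is met at all lies in the slice and keeps rank 1, whence the
    [maxn]. *)
Lemma rank_face_slice p N (L : 'M[R]_(p, N)) l t J :
  generic L l -> realized (slice L l t) J ->
  \rank (face_space (slice L l t) J)
    = maxn 1 (\rank (face_space L J)).-1.
Proof.
move=> gl rJ; have E : face_space (slice L l t) J = slice (face_space L J) l t.
  by rewrite /face_space /slice -!capmxA; congr capmx; rewrite capmxC.
have := mxrank_mul_ker (face_space L J) (l - t *: const_mx 1).
rewrite -/(slice _ _ _) -E.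
have /realizedP [z bz zJ] := rJ; have := rank_base_point bz; rewrite zJ.
have [g2|] := leqP 2 (\rank (face_space L J)); last first.
  move: (\rank _) (\rank _) (\rank _) => a b c; lia.
have [u [uF mu lu]] := gl _ g2.
have : \rank (face_space L J *m (l - t *: const_mx 1)) = 1%N.
  apply/eqP; rewrite eqn_leq rank_leq_col lt0n mxrank_eq0.
  apply: contraNneq lu => e; have /submxP [D uD] := uF.
  have := mulmxA D (face_space L J) (l - t *: const_mx 1).
  rewrite e mulmx0 -uD => /matrixP /(_ 0 0).
  by rewrite -/(dot _ u) dot_slice mu mulr0 subr0 mxE => ->.
move=> ->; move: (\rank _) (\rank _) g2 => a b; lia.
Qed.

Lemma realized_slice_between p N (L : 'M[R]_(p, N)) l x y t :
  base_point L x -> base_point L y -> dot l x < t -> t < dot l y ->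
  realized (slice L l t) (zset x :&: zset y).
Proof.
move=> bx by_ xt ty; pose a := (dot l y - t) / (dot l y - dot l x).
have d0 : 0 < dot l y - dot l x by lra.
have a01 : 0 < a < 1.
  by rewrite divr_gt0 //= ?subr_gt0 // ltr_pdivrMr // mul1r; lra.
have [bz zz] := base_point_mix bx by_ a01.
apply/realized_slice; eexists; split; [exact: bz| |exact: zz].
by rewrite dotD !dotZ /a; field; rewrite gt_eqF.
Qed.

Definition is_ray p N (L : 'M[R]_(p, N)) J :=
  realized L J && (\rank (face_space L J) == 1%N).

(** A ray has a single point of mass 1, so only the slice at the height of that point meets it. The
    value of [h] on other sets is arbitrary. *)
Lemma ray_height p N (L : 'M[R]_(p, N)) l :
  exists h : {set 'I_N} -> R, forall J t, is_ray L J ->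
    realized (slice L l t) J = (t == h J).
Proof.
have H J : exists a, forall t, is_ray L J -> realized (slice L l t) J = (t == a).
  have [/andP[/realizedP[z bz zJ] /eqP r1]|nr] := boolP (is_ray L J); last first.
    by exists 0.
  exists (dot l z) => t _; apply/realized_slice/eqP => [|->]; last by exists z.
  case=> y [by_ <- yJ].
  have zF : (z <= face_space L J)%MS by apply: base_point_face; rewrite ?zJ.
  have yF : (y <= face_space L J)%MS by apply: base_point_face; rewrite ?yJ.
  have Fz : (face_space L J <= z)%MS.
    rewrite -(geq_leqif (mxrank_leqif_sup zF)) r1 lt0n mxrank_eq0.
    exact: base_point_neq0 bz.
  have /sub_rVP [k yk] := submx_trans yF Fz.
  have [_ _ mz] := bz; have [_ _] := by_.
  by rewrite yk /mass dotZ -/(mass _) mz mulr1 => ->; rewrite scale1r.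
by have [h hP] := boolp.choice H; exists h => J t /hP.
Qed.

Lemma ray_in_face p N (L : 'M[R]_(p, N)) z :
  base_point L z -> exists2 J, is_ray L J & zset z \subset J.
Proof.
have [l gl] := exists_generic L => /(ascend_to_ray gl) [r [br zr rr _]].
exists (zset r) => //; rewrite /is_ray rr eqxx andbT; apply/realizedP.
by exists r.
Qed.

(** Ascend from a point of the face along [-l] and along [l]; the gain is strict because the
    starting face is not a ray. *)
Lemma ray_below p N (L : 'M[R]_(p, N)) l h J t :
  generic L l ->
  (forall J t, is_ray L J -> realized (slice L l t) J = (t == h J)) ->
  (2 <= \rank (face_space L J))%N -> realized (slice L l t) J ->
  (exists2 K, is_ray L K && (J \subset K) & h K < t) /\
  (exists2 K, is_ray L K && (J \subset K) & t < h K).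
Proof.
move=> gl hP r2 /realized_slice[z [bz <- zJ]].
have rn1 : (\rank (face_space L (zset z)) == 1%N) = false.
  by rewrite zJ gtn_eqF.
have ray r : base_point L r -> \rank (face_space L (zset r)) = 1%N ->
    is_ray L (zset r) /\ h (zset r) = dot l r.
  move=> br rr; have ir : is_ray L (zset r).
    by rewrite /is_ray rr eqxx andbT; apply/realizedP; exists r.
  by split=> //; apply/esym/eqP; rewrite -(hP _ _ ir); apply/realized_slice; exists r.
split.
  have [r [br zr rr lr]] := ascend_to_ray (genericN gl) bz.
  have [ir hr] := ray r br rr; exists (zset r); rewrite ?ir -?zJ // hr.
  by have := lr; rewrite rn1 => /lt_leif; rewrite !dotNl ltrN2 => ->.
have [r [br zr rr lr]] := ascend_to_ray gl bz.
have [ir hr] := ray r br rr; exists (zset r); rewrite ?ir -?zJ // hr.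
by have := lr; rewrite rn1 => /lt_leif => ->.
Qed.

(** [A] and [B] are the lowest and the highest ray of the face. Mixing a point with zero set [J]
    with the point of an extreme ray keeps the zero set [J], so every height strictly in between
    occurs. *)
Lemma face_heights p N (L : 'M[R]_(p, N)) l h J :
  generic L l ->
  (forall J t, is_ray L J -> realized (slice L l t) J = (t == h J)) ->
  realized L J -> (2 <= \rank (face_space L J))%N ->
  exists A B, [/\ is_ray L A, is_ray L B &
    forall t, realized (slice L l t) J = (h A < t < h B)].
Proof.
move=> gl hP /realizedP[z bz zJ] r2.
have rz : realized (slice L l (dot l z)) J by apply/realized_slice; exists z.
have [[K0 K0P _] _] := ray_below gl hP r2 rz.
pose P K := is_ray L K && (J \subset K).
have [A PA hA] : exists2 A, P A & forall K, P K -> h A <= h K.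
  by exists [arg min_(K < K0 | P K) h K]%O; case: arg_minP.
have [B PB hB] : exists2 B, P B & forall K, P K -> h K <= h B.
  by exists [arg max_(K > K0 | P K) h K]%O; case: arg_maxP.
have [rA JA] := andP PA; have [rB JB] := andP PB.
have pt K : is_ray L K -> exists y, [/\ base_point L y, dot l y = h K & zset y = K].
  by move=> rK; apply/realized_slice; rewrite hP.
exists A, B; split=> // t; apply/idP/andP => [rt|[At tB]].
  have [[K PK Kt] [K' PK' tK']] := ray_below gl hP r2 rt; split.
    exact: le_lt_trans (hA K PK) Kt.
  exact: lt_le_trans tK' (hB K' PK').
have [tz|zt|->] := ltgtP t (dot l z); last exact: rz.
  have [y [by_ hy yA]] := pt A rA; rewrite -hy in At.
  have := realized_slice_between by_ bz At tz.
  by rewrite yA zJ (finset.setIidPr JA).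
have [y [by_ hy yB]] := pt B rB; rewrite -hy in tB.
have := realized_slice_between bz by_ zt tB.
by rewrite yB zJ (finset.setIidPl JB).
Qed.

Lemma pos_lower_bound (s : seq R) :
  exists2 d, 0 < d & forall x, x \in s -> 0 < x -> d < x.
Proof.
elim: s => [|y s [d d0 ds]]; first by exists 1.
have [y0|y0] := ltP 0 y; last first.
  exists d => // x; rewrite inE => /orP[/eqP -> | /ds //].
  by move=> /(le_lt_trans y0); rewrite ltxx.
exists (Num.min d (y / 2)); first by rewrite lt_min d0 divr_gt0.
move=> x; rewrite inE gt_min => /orP[/eqP -> _ | /ds h /h -> //].
by apply/orP; right; lra.
Qed.

(** Applied to the ray heights, this gives a step [d] such that [x + d] lies strictly between [x]
    and the next height. *)
Lemma exists_gap (s : seq R) :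
  exists2 d, 0 < d & forall x y, x \in s -> y \in s -> x < y -> x + d < y.
Proof.
have [d d0 H] := pos_lower_bound [seq y - x | y <- s, x <- s].
exists d => // x y xs ys xy.
have : d < y - x by apply: H; [exact: allpairs_f | rewrite subr_gt0].
lra.
Qed.

(** The rank is one more than the dimension of the base of the face, and the empty face of the base
    is left out. This is thus the usual Euler characteristic up to sign, which explains the expected
    value -1. *)
Definition euler_char p N (L : 'M[R]_(p, N)) : int :=
  \sum_(J | realized L J) (-1) ^+ \rank (face_space L J).

(** All slices are indexed by the faces of [L], so that slices at different heights can be compared
    term by term. *)
Lemma euler_slice p N (L : 'M[R]_(p, N)) l t : generic L l ->
  euler_char (slice L l t) = \sum_(J | realized L J)
    (realized (slice L l t) J)%:R * (-1) ^+ maxn 1 (\rank (face_space L J)).-1.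
Proof.
move=> gl; rewrite /euler_char big_mkcond [RHS]big_mkcond /=.
apply: eq_bigr => J _; have [rs|_] := boolP (realized _ J).
  by rewrite (realized_slice_realized rs) mul1r rank_face_slice.
by rewrite mul0r if_same.
Qed.

Lemma rank1_euler p N (L : 'M[R]_(p, N)) z :
  base_point L z -> (\rank L <= 1)%N -> euler_char L = -1.
Proof.
move=> bz r1.
have LF J : (face_space L J <= L)%MS by exact: capmxSl.
have H J : realized L J = (J == zset z) /\
    (realized L J -> \rank (face_space L J) = 1%N).
  have zL : (L <= z)%MS.
    have [zL _ _] := bz; rewrite -(geq_leqif (mxrank_leqif_sup zL)).
    by apply: leq_trans r1 _; rewrite lt0n mxrank_eq0 (base_point_neq0 bz).
  split; last first.
    case/realizedP => y by_ <-; apply/eqP; rewrite eqn_leq rank_base_point // andbT.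
    exact: leq_trans (mxrankS (LF _)) r1.
  apply/realizedP/eqP => [[y [yL _ my] <-]|->]; last by exists z.
  have /sub_rVP [k yk] := submx_trans yL zL.
  have [_ _ mz] := bz.
  by move: my; rewrite yk /mass dotZ -/(mass _) mz mulr1 => ->; rewrite scale1r.
rewrite /euler_char (big_pred1 (zset z)) => [|J]; last by have [] := H J.
by have [e ->] := H (zset z); rewrite ?e.
Qed.

(* The heights at which the relative interior of a face of rank at least 2
   is met form an open interval between ray heights, so passing from [x] to
   [x + d] for every ray height [x] enters it exactly once; a ray is only
   left.  On the other hand all slices have Euler characteristic -1 except the
   empty one just above the top. *)
Theorem euler_cone p N (L : 'M[R]_(p, N)) z :
  base_point L z -> euler_char L = -1.
Proof.
move: {2}(\rank L) (leqnn (\rank L)) => k.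
elim: k p L z => [|k IH] p L z rk bz; first by apply: rank1_euler bz _; lia.
have [r1|r2] := leqP (\rank L) 1; first exact: rank1_euler bz r1.
have [l gl] := exists_generic L; have [h hP] := ray_height L l.
pose T := undup [seq h J | J <- enum (is_ray L)].
have hT J : is_ray L J -> h J \in T.
  by move=> rJ; rewrite mem_undup map_f // mem_enum.
have [d d0 gap] := exists_gap T.
have slice_e t y : base_point L y -> dot l y = t -> euler_char (slice L l t) = -1.
  move=> by_ hy; apply: (IH _ (slice L l t) y); last by apply/base_point_slice.
  have [|u [uF mu lu]] := gl finset.set0; first by rewrite rank_face_set0.
  have uL : (u <= L)%MS by apply: submx_trans uF (capmxSl _ _).
  rewrite -ltnS; apply: leq_trans rk.
  have sub : (slice L l t <= L)%MS by exact: capmxSl.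
  rewrite (ltn_leqif (mxrank_leqif_sup sub)); apply: contra lu => Ls.
  have := submx_trans uL Ls; rewrite sub_capmx => /andP[_ /sub_kermxP H].
  by have := dot_slice l t u; rewrite {1}/dot H mxE mu mulr0 subr0 => <-.
have ray_pt x : x \in T -> exists2 y, base_point L y & dot l y = x.
  rewrite mem_undup => /mapP[J]; rewrite mem_enum => rJ ->.
  have /realized_slice [y [by_ hy _]] : realized (slice L l (h J)) J by rewrite hP.
  by exists y.
have [J0 J0P _] := ray_in_face bz.
have [m mT mM] : exists2 m, m \in T & forall x, x \in T -> x <= m.
  pose J1 := [arg max_(J > J0 | is_ray L J) h J]%O.
  have [r1 r1M] : is_ray L J1 /\ forall J, is_ray L J -> h J <= h J1.
    by rewrite /J1; case: arg_maxP.
  exists (h J1); first exact: hT.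
  by move=> x; rewrite mem_undup => /mapP[J]; rewrite mem_enum => rJ ->; apply: r1M.
(* An ascent from a point at height [m + d] would end on a ray higher than the top height [m]. *)
have empty_top : euler_char (slice L l (m + d)) = 0.
  rewrite /euler_char big_pred0 // => J; apply/negP => /realized_slice[y [by_ hy _]].
  have [r [br _ rr lr]] := ascend_to_ray gl by_.
  have ir : is_ray L (zset r).
    by rewrite /is_ray rr eqxx andbT; apply/realizedP; exists r.
  have hr : dot l r = h (zset r).
    by apply/eqP; rewrite -(hP _ _ ir); apply/realized_slice; exists r.
  have := mM _ (hT _ ir); rewrite -hr; have := lr.1; rewrite hy; lra.
(* The characteristic changes only at the top height, from -1 to 0; for every other [x] both slices
   are nonempty and the term vanishes. *)
have jump : \sum_(x <- T) (euler_char (slice L l (x + d)) - euler_char (slice L l x)) = 1.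
  rewrite (bigD1_seq m) ?undup_uniq //= empty_top.
  have [y by_ hy] := ray_pt m mT; rewrite (slice_e m y by_ hy) big_seq_cond big1.
    by [].
  move=> x /andP[xT xm]; have [v bv hv] := ray_pt x xT; rewrite (slice_e x v bv hv).
  have xdm : x + d < m by apply: gap => //; rewrite lt_neqAle xm mM.
  have xxd : dot l v < x + d by rewrite hv; lra.
  have xdy : x + d < dot l y by rewrite hy.
  have /realized_slice [w [bw hw _]] := realized_slice_between bv by_ xxd xdy.
  by rewrite (slice_e _ w bw hw) subrr.
have cross J : realized L J ->
    \sum_(x <- T) ((realized (slice L l (x + d)) J)%:R - (realized (slice L l x) J)%:R)
    = if (2 <= \rank (face_space L J))%N then 1 else -1 :> int.
  move=> rJ; case: ifPn => [g2|ng2].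
    have [A [B [rA rB AB]]] := face_heights gl hP rJ g2.
    have hAB : h A < h B.
      have /realizedP [y by_ yJ] := rJ.
      have : realized (slice L l (dot l y)) J by apply/realized_slice; exists y.
      by rewrite AB => /andP[]; apply: lt_trans.
    rewrite (bigD1_seq (h A)) ?hT ?undup_uniq //= !AB ltxx /=.
    have -> : h A < h A + d by lra.
    rewrite gap ?hT //= big_seq_cond big1 ?addr0 //.
    move=> x /andP[xT xA]; rewrite !AB.
    have -> : (h A < x + d) = (h A < x).
      apply/idP/idP => [H|]; last by lra.
      rewrite ltNge; apply/negP => H'.
      have := gap x (h A) xT (hT _ rA); rewrite lt_neqAle xA H' => /(_ isT); lra.
    have -> : (x + d < h B) = (x < h B).
      apply/idP/idP => [|H]; first by lra.
      by rewrite gap ?hT.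
    by rewrite subrr.
  have rayJ : is_ray L J.
    rewrite /is_ray rJ eqn_leq leqNgt ng2 /=.
    by have /realizedP [y by_ <-] := rJ; apply: rank_base_point.
  rewrite (bigD1_seq (h J)) ?hT ?undup_uniq //= !hP // eqxx big_seq_cond big1.
    by have -> : (h J + d == h J) = false by apply/eqP; lra.
  move=> x /andP[xT xJ]; rewrite !hP // (negPf xJ).
  suff -> : (x + d == h J) = false by [].
  apply/eqP => e; have := gap x (h J) xT (hT _ rayJ).
  by rewrite -e => H; have := H ltac:(lra); lra.
have := jump; under eq_bigr => x _ do rewrite !euler_slice // -sumrB.
rewrite exchange_big /=.
under eq_bigr => J rJ.
  under eq_bigr => x _ do rewrite -mulrBl.
  rewrite -mulr_suml cross //.
  (* A face of rank at least 2 loses one rank in a slice; a ray loses none, but is crossed with sign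
     -1. Both cases give the opposite of the sign in [euler_char L]. *)
  have -> : (if (2 <= \rank (face_space L J))%N then 1 else -1 : int)
      * (-1) ^+ maxn 1 (\rank (face_space L J)).-1 = - (-1) ^+ \rank (face_space L J).
    have : (0 < \rank (face_space L J))%N.
      by have /realizedP [y by_ <-] := rJ; apply: rank_base_point.
    case: (\rank _) => [|[|n]] //= _.
    by rewrite (maxn_idPr _) // mul1r [in RHS]exprS mulN1r opprK.
  over.
rewrite sumrN -/(euler_char L) => e.
by rewrite -[euler_char L]opprK e.
Qed.

End Euler.

(** * Faces of convex hulls *)

Section Hulls.
Context {R : realType}.

Definition hull (I : finType) m (v : I -> 'rV[R]_m) (S : {set I}) : set 'rV[R]_m :=
  [set x | exists w : I -> R, [/\ forall i, 0 <= w i,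
     forall i, i \notin S -> w i = 0, \sum_i w i = 1 & x = \sum_i w i *: v i]].

Definition max_set (I : finType) m (v : I -> 'rV[R]_m) (S : {set I}) c b : {set I} :=
  [set i in S | dot c (v i) == b].

Definition exposed (I : finType) m (v : I -> 'rV[R]_m) (S T : {set I}) : Prop :=
  exists c b, (forall i, i \in S -> dot c (v i) <= b) /\ T = max_set v S c b.

Lemma dot_sum m (c : 'cV[R]_m) (I : finType) (w : I -> R) (v : I -> 'rV[R]_m) :
  dot c (\sum_i w i *: v i) = \sum_i w i * dot c (v i).
Proof.
rewrite /dot mulmx_suml summxE; apply: eq_bigr => i _.
by rewrite -scalemxAl mxE.
Qed.

Lemma conv_hullE m N (v : 'I_N -> 'rV[R]_m) : conv_hull v = hull v [set: 'I_N]%SET.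
Proof.
apply/seteqP; split=> x [w] => [[w0 w1 ->]|[w0 _ w1 ->]]; exists w => //; split=> //.
by move=> i; rewrite finset.in_setT.
Qed.

Lemma hull_reindex (I J : finType) m (v : I -> 'rV[R]_m) (f : J -> I) (S : {set J}) :
  injective f -> hull (v \o f) S = hull v (f @: S).
Proof.
move=> fi; apply/seteqP; split=> x [w [w0 wS w1 ->]].
  exists (fun i => \sum_(j | f j == i) w j); split.
  - by move=> i; apply: sumr_ge0.
  - move=> i iS; apply: big1 => j /eqP fj; apply: wS; apply: contra iS => jS.
    by rewrite -fj imset_f.
  - rewrite -w1 (partition_big f predT) //=.
  - rewrite (partition_big f predT) //=; apply: eq_bigr => i _.
    by rewrite scaler_suml; apply: eq_bigr => j /eqP ->.
have E (V : nmodType) (F : I -> V) : (forall i, i \notin f @: S -> F i = 0) ->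
    \sum_i F i = \sum_j F (f j).
  move=> F0; rewrite (bigID (mem (f @: S))) [RHS](bigID (mem S)) /=.
  rewrite (big_imset F (in2W fi)) [X in _ + X]big1 ?[X in _ = _ + X]big1 // => j jS.
  by rewrite F0 // mem_imset.
exists (w \o f); split=> [j|j jS||] /=.
- exact: w0.
- by apply: wS; rewrite mem_imset.
- by rewrite -w1 -E.
- by apply: E => i /wS ->; rewrite scale0r.
Qed.

Lemma hull_polytope (I : finType) m (v : I -> 'rV[R]_m) (S : {set I}) :
  is_polytope (hull v S).
Proof.
pose f (k : 'I_#|S|) : I := enum_val k; have fi : injective f by apply: enum_val_inj.
exists #|S|, (v \o f); rewrite conv_hullE (hull_reindex _ _ fi).
congr (hull v _); apply/setP => i; apply/idP/imsetP => [iS|[k _ ->]]; last exact: enum_valP.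
by exists (enum_rank_in iS i); rewrite ?finset.in_setT // /f enum_rankK_in.
Qed.

Lemma hull_sub (I : finType) m (v : I -> 'rV[R]_m) (S T : {set I}) :
  S \subset T -> hull v S `<=` hull v T.
Proof.
move=> ST x [w [w0 wS w1 ->]]; exists w; split=> // i iT; apply: wS.
by apply: contra iT; apply: (fintype.subsetP ST).
Qed.

Lemma hull_vertex (I : finType) m (v : I -> 'rV[R]_m) (S : {set I}) i :
  i \in S -> hull v S (v i).
Proof.
move=> iS; exists (fun j => (j == i)%:R); split=> [j|j jS||].
- exact: ler0n.
- by case: eqP jS => // ->; rewrite iS.
- by rewrite (bigD1 i) //= eqxx big1 ?addr0 // => j /negPf ->.
- rewrite (bigD1 i) //= eqxx scale1r big1 ?addr0 // => j /negPf ->.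
  by rewrite scale0r.
Qed.

Lemma hull_set0 (I : finType) m (v : I -> 'rV[R]_m) : hull v finset.set0 = set0.
Proof.
rewrite -subset0 => x [w [_ w0 w1 _]]; move: w1.
rewrite big1 => [|i _]; last by rewrite w0 // inE.
by move/eqP; rewrite eq_sym oner_eq0.
Qed.

Lemma hull_eq0 (I : finType) m (v : I -> 'rV[R]_m) (S : {set I}) :
  hull v S = set0 <-> S = finset.set0.
Proof.
split=> [e|->]; last exact: hull_set0.
apply/eqP; rewrite -finset.subset0; apply/fintype.subsetP => i iS.
by have := hull_vertex v iS; rewrite e.
Qed.

(** The gap [b - dot c x] is the average, with the weights of [x], of the nonnegative gaps at the
    points [v i]; it is zero only if no weight sits on a positive gap. *)
Lemma hull_max (I : finType) m (v : I -> 'rV[R]_m) (S : {set I}) c b :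
  (forall i, i \in S -> dot c (v i) <= b) ->
  (forall x, hull v S x -> dot c x <= b) /\
  [set x | hull v S x /\ dot c x = b] = hull v (max_set v S c b).
Proof.
move=> cb.
have E (w : I -> R) : \sum_i w i = 1 ->
    b - dot c (\sum_i w i *: v i) = \sum_i w i * (b - dot c (v i)).
  move=> w1; rewrite dot_sum -{1}[b]mul1r -w1 mulr_suml -sumrB.
  by apply: eq_bigr => i _; rewrite mulrBr.
have pos (w : I -> R) : (forall i, 0 <= w i) -> (forall i, i \notin S -> w i = 0) ->
    forall i, 0 <= w i * (b - dot c (v i)).
  move=> w0 wS i; have [iS|/wS ->] := boolP (i \in S); last by rewrite mul0r.
  by rewrite mulr_ge0 // subr_ge0 cb.
split=> [x [w [w0 wS w1 ->]]|].
  by rewrite -subr_ge0 E // sumr_ge0 // => i _; apply: pos.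
apply/seteqP; split=> [x [[w [w0 wS w1 ->]] e]|x].
  exists w; split=> // i; rewrite inE negb_and.
  have := E w w1; rewrite e subrr => /esym/eqP.
  rewrite psumr_eq0 => [/allP /(_ i)|j _]; last exact: pos.
  rewrite mem_index_enum mulf_eq0 subr_eq0 => /(_ isT) /orP[/eqP //|/eqP h].
  by rewrite -h eqxx orbF => /wS.
move=> h; split.
  by apply: hull_sub h; apply/fintype.subsetP => i; rewrite inE => /andP[].
case: h => w [w0 wS w1 ->]; apply/eqP; rewrite eq_sym -subr_eq0 E //; apply/eqP.
apply: big1 => i _; have [|/wS ->] := boolP (i \in max_set v S c b); last by rewrite mul0r.
by rewrite inE => /andP[_ /eqP ->]; rewrite subrr mulr0.
Qed.

Lemma facesP (I : finType) m (v : I -> 'rV[R]_m) (S : {set I}) F :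
  faces (hull v S) F <-> exists2 T, exposed v S T & F = hull v T.
Proof.
split=> [[c [b [cb ->]]]|[T [c [b [cb ->]]] ->]].
  have cb' i : i \in S -> dot c (v i) <= b by move=> iS; apply: cb; apply: hull_vertex.
  exists (max_set v S c b); first by exists c, b.
  by have [_ <-] := hull_max cb'.
by have [H <-] := hull_max cb; exists c, b.
Qed.

Lemma exposed_sub (I : finType) m (v : I -> 'rV[R]_m) (S T : {set I}) :
  exposed v S T -> T \subset S.
Proof. by case=> c [b [_ ->]]; apply/fintype.subsetP => i; rewrite inE => /andP[]. Qed.

Lemma exposed_vertex (I : finType) m (v : I -> 'rV[R]_m) (S T : {set I}) i :
  exposed v S T -> i \in S -> hull v T (v i) <-> i \in T.
Proof.
move=> [c [b [cb ->]]] iS; split; last exact: hull_vertex.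
by have [_ <-] := hull_max cb => -[_ /eqP e]; rewrite inE iS.
Qed.

Lemma exposed_hull_sub (I : finType) m (v : I -> 'rV[R]_m) (S T T' : {set I}) :
  T \subset S -> exposed v S T' -> hull v T `<=` hull v T' <-> T \subset T'.
Proof.
move=> TS e; split; last exact: hull_sub.
move=> H; apply/fintype.subsetP => i iT; apply/(exposed_vertex e).
  exact: (fintype.subsetP TS).
by apply: H; apply: hull_vertex.
Qed.

Lemma exposed_hull_inj (I : finType) m (v : I -> 'rV[R]_m) (S T T' : {set I}) :
  exposed v S T -> exposed v S T' -> hull v T = hull v T' -> T = T'.
Proof.
move=> e e' h; apply/eqP; rewrite finset.eqEsubset.
apply/andP; split.
  by apply/(exposed_hull_sub (exposed_sub e) e'); rewrite h.
by apply/(exposed_hull_sub (exposed_sub e') e); rewrite h.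
Qed.

Lemma exposed_refl (I : finType) m (v : I -> 'rV[R]_m) (S : {set I}) : exposed v S S.
Proof.
exists 0, 0; split=> [i _|]; first by rewrite /dot mulmx0 mxE.
by apply/setP => i; rewrite inE /dot mulmx0 mxE eqxx andbT.
Qed.

Lemma exposed_set0 (I : finType) m (v : I -> 'rV[R]_m) (S : {set I}) :
  exposed v S finset.set0.
Proof.
exists 0, 1; split=> [i _|]; first by rewrite /dot mulmx0 mxE ler01.
by apply/setP => i; rewrite !inE /dot mulmx0 mxE eq_sym oner_eq0 andbF.
Qed.

(* A functional valid on the face [T] becomes valid on [S] after adding a
   large multiple of the functional defining [T]. *)
Lemma exposed_trans (I : finType) m (v : I -> 'rV[R]_m) (S T U : {set I}) :
  exposed v S T -> exposed v T U <-> exposed v S U /\ U \subset T.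
Proof.
move=> eT; split=> [eU|[[c [b [cb ->]]] UT]]; last first.
  have TS := exposed_sub eT.
  exists c, b; split=> [i iT|]; first exact/cb/(fintype.subsetP TS).
  apply/setP => i; rewrite !inE; apply/idP/andP => [iU|[iT ->]].
    by split; [apply: (fintype.subsetP UT); rewrite inE | have /andP[] := iU].
  by rewrite (fintype.subsetP TS _ iT).
split; last exact: exposed_sub eU.
case: eT eU => c [b [cb eT]] [c' [b' [cb' ->]]].
have [M M0 HM] : exists2 M, 0 <= M & forall i, i \in S -> i \notin T ->
    dot c' (v i) - b' < M * (b - dot c (v i)).
  (* The multiple [f i] suffices at the index [i], so the sum of all these nonnegative numbers
     suffices everywhere. *)
  pose f i := (`|dot c' (v i) - b'| + 1) / (b - dot c (v i)).
  have f0 i : i \in S -> i \notin T -> 0 < b - dot c (v i).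
    move=> iS; rewrite eT inE iS /= => h.
    by rewrite subr_gt0 lt_neqAle h cb.
  have fp i : i \in S -> i \notin T -> 0 <= f i.
    by move=> iS iT; apply: divr_ge0; [exact: addr_ge0 | exact/ltW/f0].
  exists (\sum_(i in S :\: T) f i).
    by apply: sumr_ge0 => i; rewrite inE => /andP[iT iS]; apply: fp.
  move=> i iS iT; apply: (@lt_le_trans _ _ (f i * (b - dot c (v i)))).
    rewrite /f divfK ?gt_eqF ?f0 //.
    by apply: le_lt_trans (ler_norm _) _; rewrite ltrDl.
  rewrite ler_pM2r ?f0 // (bigD1 i) /=; last by rewrite inE iT.
  rewrite lerDl; apply: sumr_ge0 => j; rewrite inE => /andP[/andP[jT jS] _]; exact: fp.
have D i : dot (c' + M *: c) (v i) = dot c' (v i) + M * dot c (v i).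
  by rewrite /dot mulmxDr -scalemxAr !mxE.
have Tb i : i \in T -> dot c (v i) = b by rewrite eT inE => /andP[_ /eqP].
exists (c' + M *: c), (b' + M * b); split=> [i iS|].
  rewrite D; have [iT|iT] := boolP (i \in T); last by have := HM i iS iT; lra.
  by rewrite (Tb i iT) lerD2r cb'.
apply/setP => i; rewrite !inE D.
have [iT|iT] := boolP (i \in T).
  rewrite (Tb i iT) (inj_eq (addIr _)).
  by move: iT; rewrite eT inE => /andP[-> _].
have [iS|//] := boolP (i \in S); apply/esym/eqP => e; have := HM i iS iT; lra.
Qed.

Lemma faces_of_face (I : finType) m (v : I -> 'rV[R]_m) (S T : {set I}) F :
  exposed v S T -> faces (hull v T) F <-> faces (hull v S) F /\ F `<=` hull v T.
Proof.
move=> eT; rewrite !facesP; split=> [[U eU ->]|[[U eU ->]] UT].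
  have [eSU UT] := (exposed_trans _ eT).1 eU.
  by split; [exists U | apply: hull_sub].
exists U => //; apply/(exposed_trans _ eT); split=> //.
by apply/(exposed_hull_sub (exposed_sub eU) eT).
Qed.

(** A face is determined by the indices of the generating points it contains, and inclusion of faces
    is inclusion of these index sets. Equal families of exposed sets therefore give isomorphic face
    lattices. *)
Lemma comb_equiv_exposed (I : finType) m n (u : I -> 'rV[R]_m) (w : I -> 'rV[R]_n) :
  (forall S, exposed u [set: I]%SET S <-> exposed w [set: I]%SET S) ->
  comb_equiv (faces (hull u [set: I]%SET)) (faces (hull w [set: I]%SET)).
Proof.
move=> uw; pose s (F : set 'rV[R]_m) : {set I} := [set i | `[< F (u i) >]]%SET.
have sE S : exposed u [set: I]%SET S -> s (hull u S) = S.
  move=> eS; apply/setP => i; rewrite inE; apply/asboolP/idP.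
    by move/(exposed_vertex eS (finset.in_setT _)).
  exact: hull_vertex.
exists (fun F => hull w (s F)); split.
  split=> [F /= /facesP [S eS ->]|F G|F /facesP [S eS ->]].
  - by rewrite sE //; apply/facesP; exists S => //; apply/uw.
  - rewrite !in_setE => /facesP [S eS ->] /facesP [T eT ->]; rewrite !sE //.
    by move/(exposed_hull_inj ((uw _).1 eS) ((uw _).1 eT)) ->.
  - have /uw eS' := eS; exists (hull u S); last by rewrite sE.
    by apply/facesP; exists S.
move=> F G /facesP [S eS ->] /facesP [T eT ->]; rewrite !sE //.
have /uw eS' := eS; have /uw eT' := eT.
by rewrite (exposed_hull_sub (exposed_sub eS) eT) (exposed_hull_sub (exposed_sub eS') eT').
Qed.

End Hulls.

(** * Slack vectors, and dimension of faces as a rank *)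

Section Dimension.
Context {R : realType}.

(** The row space consists of the value vectors of affine functionals at the points [v i]; its
    nonnegative members are the slack vectors of valid inequalities. *)
Definition slacks m N (v : 'I_N -> 'rV[R]_m) : 'M[R]_(m + 1, N) :=
  col_mx (\matrix_(j, i) v i 0 j) (const_mx 1).

Lemma row_slacks m N (v : 'I_N -> 'rV[R]_m) (z : 'rV[R]_N) :
  reflect (exists c b, forall i, z 0 i = b - dot c (v i)) (z <= slacks v)%MS.
Proof.
have E (D1 : 'rV[R]_m) (D2 : 'rV[R]_1) i :
    (row_mx D1 D2 *m slacks v) 0 i = D2 0 0 + dot D1^T (v i).
  rewrite mul_row_col mxE addrC /dot !mxE big_ord1 mxE mulr1; congr (_ + _).
  by apply: eq_bigr => j _; rewrite !mxE mulrC.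
apply: (iffP submxP) => [[D ->]|[c [b H]]].
  exists (- (lsubmx D)^T), (rsubmx D 0 0) => i.
  by rewrite -{1}[D]hsubmxK E dotNl opprK.
exists (row_mx (- c^T) b%:M); apply/rowP => i; rewrite H E linearN /= trmxK dotNl.
by rewrite mxE mulr1n.
Qed.

(** The slack vector of a valid inequality can be scaled to mass 1 unless it is zero, and a zero
    slack vector exposes the full index set. *)
Lemma exposed_realized m N (v : 'I_N -> 'rV[R]_m) (J : {set 'I_N}) :
  exposed v [set: 'I_N]%SET J <-> J = [set: 'I_N]%SET \/ realized (slacks v) J.
Proof.
split=> [[c [b [cb ->]]]|[->|/realizedP[z [zW z0 _] <-]]]; last 2 first.
- exact: exposed_refl.
- have /row_slacks [c [b H]] := zW; exists c, b; split=> [i _|].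
    by rewrite -subr_ge0 -H.
  by apply/setP => i; rewrite !inE H subr_eq0 eq_sym.
pose z : 'rV[R]_N := \row_i (b - dot c (v i)).
have z0 i : 0 <= z 0 i by rewrite mxE subr_ge0 cb.
have zJ : zset z = max_set v [set: 'I_N]%SET c b.
  by apply/setP => i; rewrite !inE mxE subr_eq0 eq_sym.
have [m0|m0] := eqVneq (mass z) 0.
  left; rewrite -zJ; apply/setP => i; rewrite !inE.
  move: m0; rewrite massE => /eqP; rewrite psumr_eq0 // => /allP /(_ i).
  by rewrite mem_index_enum => /(_ isT).
right; apply/realizedP; exists ((mass z)^-1 *: z); last first.
  by rewrite -zJ; apply/setP => i; rewrite !inE mxE mulf_eq0 invr_eq0 (negPf m0).
split.
- apply: scalemx_sub; apply/row_slacks; exists c, b => i; by rewrite mxE.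
- by move=> i; rewrite mxE mulr_ge0 // invr_ge0 massE sumr_ge0.
- by rewrite /mass dotZ mulVf.
Qed.

Lemma has_dim_inj m (A : set 'rV[R]_m) k l : has_dim A k -> has_dim A l -> k = l.
Proof.
suff H k' l' : has_dim A k' -> has_dim A l' -> (k' <= l')%N.
  by move=> h h'; apply/eqP; rewrite eqn_leq !H.
move=> [x [B [Ax fB AB _]]] [y [C [Ay fC _ CA]]].
have /eqP <- := fB; have /eqP <- := fC; apply: mxrankS.
apply/row_subP => i; have -> : row i B = (x + row i B - y) - (x - y).
  by rewrite opprB addrA addrNK addrAC subrr add0r.
by rewrite addmx_sub ?eqmx_opp ?CA.
Qed.

Lemma mask_mul N p (S : {set 'I_N}) (A : 'M[R]_(N, p)) i :
  row i (mask S *m A) = (i \in S)%:R *: row i A.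
Proof. by apply/rowP => j; rewrite mxE mul_diag_mx !mxE. Qed.

(** The columns of [slacks v] are the points with an entry 1 appended. Those in [T] span the
    differences [v i - v i0] together with the lifted point [v i0], which adds one dimension because
    its last entry is not 0. *)
Lemma hull_has_dim m N (v : 'I_N -> 'rV[R]_m) (T : {set 'I_N}) i0 :
  i0 \in T -> exists2 k, has_dim (hull v T) k & \rank (slacks v *m mask T) = k.+1.
Proof.
move=> i0T; pose D := \matrix_i ((i \in T)%:R *: (v i - v i0)).
have rD i : row i D = (i \in T)%:R *: (v i - v i0) by rewrite rowK.
exists (\rank D).
  exists (v i0), (rowsub (maxrankfun D) D); split.
  - exact: hull_vertex.
  - exact: maxrowsub_free.
  - move=> i; rewrite -[row i _](_ : row (maxrankfun D i) D = _); last first.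
      by apply/rowP => j; rewrite !mxE.
    rewrite rD; have [iT|iT] := boolP (maxrankfun D i \in T); rewrite ?scale1r ?scale0r.
      by rewrite addrC subrK; apply: hull_vertex.
    by rewrite addr0; apply: hull_vertex.
  - move=> x [w [w0 wT w1 ->]].
    have /eqmxP/andP[_] := eq_maxrowsub D; apply: submx_trans.
    have -> : \sum_i w i *: v i - v i0 = \sum_i w i *: (v i - v i0).
      rewrite -{1}[v i0]scale1r -w1 scaler_suml -sumrB.
      by apply: eq_bigr => i _; rewrite scalerBr.
    apply: summx_sub => i _; have [iT|/wT ->] := boolP (i \in T); last first.
      by rewrite scale0r sub0mx.
    apply: scalemx_sub; rewrite -[v i - _]scale1r.
    have <- : row i D = 1 *: (v i - v i0) by rewrite rD iT.
    exact: row_sub.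
rewrite -mxrank_tr trmx_mul tr_diag_mx -/(mask T).
pose A := mask T *m (slacks v)^T; rewrite -/A.
have rA i : row i A = (i \in T)%:R *: row_mx (v i) 1.
  rewrite mask_mul; congr (_ *: _); rewrite /slacks tr_col_mx row_row_mx.
  by congr row_mx; apply/rowP => j; rewrite !mxE // ord1.
pose e := row_mx (v i0) (1 : 'rV[R]_1).
have AE : (A :=: row_mx D 0 + e)%MS.
  apply/eqmxP/andP; split.
    apply/row_subP => i; rewrite rA; have [iT|_] := boolP (i \in T); last first.
      by rewrite scale0r sub0mx.
    rewrite scale1r; have -> : row_mx (v i) 1 = row i (row_mx D (0 : 'cV[R]_N)) + e.
      by rewrite row_row_mx rD iT scale1r row0 add_row_mx subrK add0r.
    by rewrite addmx_sub_adds ?row_sub.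
  have eA : (e <= A)%MS.
    by have := row_sub i0 A; rewrite rA i0T scale1r.
  rewrite addsmx_sub eA andbT; apply/row_subP => i.
  rewrite row_row_mx rD row0; have [iT|_] := boolP (i \in T); last first.
    by rewrite scale0r row_mx0 sub0mx.
  have -> : row_mx (1 *: (v i - v i0)) (0 : 'rV[R]_1) = row_mx (v i) 1 - e.
    by rewrite scale1r /e opp_row_mx add_row_mx subrr.
  rewrite addmx_sub ?eqmx_opp //.
  by have := row_sub i A; rewrite rA iT scale1r.
have cap : (row_mx D (0 : 'cV[R]_N) :&: e)%MS = 0.
  apply/eqP/rowV0P => x; rewrite sub_capmx => /andP[/submxP[a ->] /sub_rVP[k]].
  rewrite mul_mx_row mulmx0 scale_row_mx => /eq_row_mx [-> /matrixP /(_ 0 0)].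
  by rewrite !mxE mulr1 => <-; rewrite scale0r row_mx0.
have e1 : \rank e = 1%N.
  apply/eqP; rewrite eqn_leq rank_leq_row lt0n mxrank_eq0.
  apply/eqP => /matrixP /(_ 0 (rshift m 0)); rewrite row_mxEr !mxE => /eqP.
  by rewrite oner_eq0.
rewrite AE; have := mxrank_sum_cap (row_mx D (0 : 'cV[R]_N)) e.
by rewrite cap mxrank0 addn0 e1 rank_row_mx0 => ->; rewrite addn1.
Qed.

(** This is rank-nullity for the restriction of slack vectors to [T]: the source has rank [d + 1],
    the image rank [k + 1], and the kernel is the face space. *)
Lemma face_rank m N (v : 'I_N -> 'rV[R]_m) (T : {set 'I_N}) d k :
  has_dim (hull v [set: 'I_N]%SET) d -> T != finset.set0 ->
  has_dim (hull v T) k <-> (k + \rank (face_space (slacks v) T) = d)%N.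
Proof.
move=> hd /set0Pn [i iT].
have [k1 h1 r1] := hull_has_dim v iT.
have [d1 hd1 rd1] := hull_has_dim v (finset.in_setT i).
have := rank_face_space (slacks v) T; rewrite r1.
have -> : \rank (slacks v) = d.+1.
  rewrite (has_dim_inj hd hd1) -rd1; congr (\rank _).
  suff -> : mask [set: 'I_N]%SET = 1%:M :> 'M[R]_N by rewrite mulmx1.
  by apply/matrixP => a b; rewrite !mxE finset.in_setT; case: (a == b).
move=> e; split=> [h|h]; first by rewrite (has_dim_inj h h1); lia.
by have -> : k = k1 by lia.
Qed.

End Dimension.

(** * Polytopes *)

Section Polytopes.
Context {R : realType}.

Lemma polytope_hull m (P : set 'rV[R]_m) : is_polytope P ->
  exists N (v : 'I_N -> 'rV[R]_m), P = hull v [set: 'I_N]%SET.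
Proof. by case=> N [v ->]; exists N, v; rewrite conv_hullE. Qed.

Lemma face_polytope m (P F : set 'rV[R]_m) : is_polytope P -> faces P F -> is_polytope F.
Proof.
by case/polytope_hull=> N [v ->] /facesP [T _ ->]; apply: hull_polytope.
Qed.

Lemma face_subset m (P F : set 'rV[R]_m) : faces P F -> F `<=` P.
Proof. by case=> c [b [_ ->]] x []. Qed.

Lemma face_refl m (P : set 'rV[R]_m) : faces P P.
Proof.
exists 0, 0; split=> [x _|]; first by rewrite mulmx0 mxE.
by apply/seteqP; split=> [x Px|x []//]; split=> //; rewrite mulmx0 mxE.
Qed.

Lemma face_set0 m (P : set 'rV[R]_m) : faces P set0.
Proof.
exists 0, 1; split=> [x _|]; first by rewrite mulmx0 mxE ler01.
apply/esym; rewrite -subset0 => x [_]; rewrite mulmx0 mxE => /eqP.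
by rewrite eq_sym oner_eq0.
Qed.

Lemma facesE m (P F G : set 'rV[R]_m) :
  is_polytope P -> faces P F -> faces F G <-> faces P G /\ G `<=` F.
Proof.
by case/polytope_hull=> N [v ->] /facesP [T eT ->]; apply: faces_of_face.
Qed.

Lemma polytope_dim m (P : set 'rV[R]_m) : is_polytope P -> P !=set0 ->
  exists k, has_dim P k.
Proof.
case/polytope_hull=> N [v ->] /set0P /eqP /hull_eq0 /eqP /set0Pn [i iT].
by have [k hk _] := hull_has_dim v iT; exists k.
Qed.

Lemma has_dim_nonempty m (P : set 'rV[R]_m) k : has_dim P k -> P !=set0.
Proof. by case=> x [B [Px _ _ _]]; exists x. Qed.

Lemma realized_set0 m N (v : 'I_N -> 'rV[R]_m) (i : 'I_N) :
  realized (slacks v) finset.set0.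
Proof.
have /exposed_realized [/setP /(_ i)|//] := exposed_set0 v [set: 'I_N]%SET.
by rewrite !inE.
Qed.

Lemma has_dim_hull_neq0 (I : finType) m (v : I -> 'rV[R]_m) (T : {set I}) k :
  has_dim (hull v T) k -> T != finset.set0.
Proof. by case/has_dim_nonempty => x + ; apply: contraPneq => ->; rewrite hull_set0. Qed.

(** An extreme ray of the cone of slack vectors has a face space of rank 1, hence exposes a face of
    codimension 1. *)
Lemma facet_exists m (P : set 'rV[R]_m) d : is_polytope P -> has_dim P d.+1 ->
  exists2 F, faces P F & has_dim F d.
Proof.
case/polytope_hull=> N [v ->] hd; have /set0Pn [i iT] := has_dim_hull_neq0 hd.
have /realizedP [z bz _] := realized_set0 v i.
have [J /andP[rJ /eqP r1] _] := ray_in_face bz.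
have eJ : exposed v [set: 'I_N]%SET J by apply/exposed_realized; right.
exists (hull v J); first by apply/facesP; exists J.
have [k hk rk] := hull_has_dim v iT.
have J0 : J != finset.set0.
  apply: contra_eq_neq r1 => ->.
  rewrite rank_face_set0; have e := has_dim_inj hd hk.
  have := mxrankM_maxl (slacks v) (mask [set: 'I_N]%SET); rewrite rk -e.
  by case: (\rank _) => [|[]].
by apply/(face_rank d hd J0); rewrite r1 addn1.
Qed.

Lemma proper_face_dim m (P F : set 'rV[R]_m) d k : is_polytope P -> faces P F ->
  F <> P -> has_dim P d -> has_dim F k -> (k < d)%N.
Proof.
case/polytope_hull=> N [v ->] /facesP [T eT ->] nT hd hk.
have := (face_rank k hd (has_dim_hull_neq0 hk)).1 hk.
have [e|/realizedP [z bz zT]] := (exposed_realized _ _).1 eT; first by rewrite e in nT.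
have := rank_base_point bz; rewrite zT => r0 <-.
by rewrite -[ltnLHS]addn0 ltn_add2l.
Qed.

(** Induction on the dimension: a facet [G] of [F] has an image strictly inside [phi F], and proper
    faces have smaller dimension. The image is nonempty, since otherwise it would lie in [phi set0],
    which forces [G] to be empty. *)
Lemma embedding_dim_le m n (P : set 'rV[R]_m) (Q : set 'rV[R]_n) phi :
  is_polytope P -> is_polytope Q ->
  (forall F, faces P F -> faces Q (phi F)) ->
  (forall F G, faces P F -> faces P G -> (F `<=` G <-> phi F `<=` phi G)) ->
  forall F d e, faces P F -> has_dim F d -> has_dim (phi F) e -> (d <= e)%N.
Proof.
move=> pP pQ ph po F d; elim: d F => // d IH F e fF hF he.
have pF := face_polytope pP fF.
have [G fG hG] := facet_exists pF hF.
have [fPG GF] := (facesE G pP fF).1 fG.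
have nFG : ~ F `<=` G.
  move=> FG; have e1 : F = G by apply/seteqP.
  by move: hF; rewrite e1 => /(has_dim_inj hG) /eqP; rewrite ltn_eqF.
have [x Gx] := has_dim_nonempty hG.
have pG0 : phi G !=set0.
  apply/set0P/eqP => e0.
  have : phi G `<=` phi set0 by rewrite e0.
  by move/(po _ _ fPG (face_set0 _)) => /(_ x Gx).
have [k hk] := polytope_dim (face_polytope pQ (ph _ fPG)) pG0.
have dk := IH G k fPG hG hk.
apply: leq_ltn_trans dk _; apply: (proper_face_dim (face_polytope pQ (ph _ fF)) _ _ he hk).
  apply/(facesE _ pQ (ph _ fF)); split; first exact: ph.
  by apply/po.
by move=> e1; apply: nFG; apply/po => //; rewrite e1.
Qed.

Lemma bij_inverse (U V : Type) (X : set (set U)) (Y : set (set V)) phi :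
  set_bij X Y phi ->
  exists psi, [/\ forall G, Y G -> X (psi G), forall G, Y G -> phi (psi G) = G
    & forall F, X F -> psi (phi F) = F].
Proof.
move=> [fXY iX sX].
have H G : exists F, Y G -> X F /\ phi F = G.
  have [YG|nY] := pselect (Y G); last by exists set0.
  by have [F XF e] := sX G YG; exists F.
have [psi h] := boolp.choice H; exists psi; split=> [G /h[]|G /h[]|F XF] //.
have [XF' e] := h _ (fXY F XF); apply: iX => //; exact: mem_set.
Qed.

Lemma comb_equiv_dim m n (P : set 'rV[R]_m) (Q : set 'rV[R]_n) phi :
  is_polytope P -> is_polytope Q -> set_bij (faces P) (faces Q) phi ->
  (forall F G, faces P F -> faces P G -> (F `<=` G <-> phi F `<=` phi G)) ->
  forall F d, faces P F -> has_dim F d <-> has_dim (phi F) d.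
Proof.
move=> pP pQ bphi po.
have [psi [h1 h2 h3]] := bij_inverse bphi; have [ph _ _] := bphi.
have po' F G : faces Q F -> faces Q G -> (F `<=` G <-> psi F `<=` psi G).
  by move=> fF fG; rewrite (po (psi F) (psi G)) ?h2 //; apply: h1.
have le1 := embedding_dim_le pP pQ ph po.
have le2 := embedding_dim_le pQ pP h1 po'.
have e0 : phi set0 = set0.
  rewrite -subset0; have f0 := face_set0 Q.
  by rewrite -(h2 _ f0); apply/po => //; [apply: face_set0 | apply: h1].
have ne F : faces P F -> F !=set0 <-> phi F !=set0.
  move=> fF; have f0 := face_set0 P; split=> -[x xF]; apply/set0P/eqP => e.
    have : phi F `<=` phi set0 by rewrite e.
    by move/(po _ _ fF f0) => /(_ x xF).
  by move: xF; rewrite e e0.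
move=> F d fF; split=> h.
  have /(polytope_dim (face_polytope pQ (ph _ fF))) [e he] : phi F !=set0.
    by apply/ne => //; apply: has_dim_nonempty h.
  have := le1 F d e fF h he; have := le2 (phi F) e d (ph _ fF) he.
  rewrite h3 // => /(_ h) ed de; suff -> : d = e by [].
  by apply/eqP; rewrite eqn_leq de.
have /(polytope_dim (face_polytope pP fF)) [e he] : F !=set0.
  by apply/ne => //; apply: has_dim_nonempty h.
have := le1 F e d fF he h; have := le2 (phi F) d e (ph _ fF) h.
rewrite h3 // => /(_ he) ed de; suff -> : d = e by [].
by apply/eqP; rewrite eqn_leq ed.
Qed.

Lemma card_fset_bij (U V : choiceType) (X : set U) (Y : set V) f :
  finite_set X -> set_bij X Y f -> #|` fset_set X| = #|` fset_set Y|.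
Proof.
move=> fX bf; have <- := image_eq bf; rewrite fset_set_image //.
rewrite card_in_imfset // => x y; rewrite !in_fset_set //.
by have [_ iX _] := bf; apply: iX.
Qed.

Lemma card_image_finset (I : finType) (V : choiceType) (A : {set I}) (f : I -> V) (Y : set V) :
  {in A &, injective f} -> (forall y, Y y <-> exists2 i, i \in A & y = f i) ->
  #|` fset_set Y| = #|A| /\ finite_set Y.
Proof.
move=> fi YE.
pose X : set I := [set` [fset x in enum A]%fset].
have XE i : X i <-> i \in A by rewrite /X /= inE mem_enum.
have fX : finite_set X by exact: finite_fset.
have bf : set_bij X Y f.
  split=> [i /XE iA|i j|y /YE [i iA ->]].
  - by apply/YE; exists i.
  - by rewrite !in_setE => /XE iA /XE jA; apply: fi.
  - by exists i => //; apply/XE.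
split.
  rewrite -(card_fset_bij fX bf) /X set_fsetK card_fseq undup_id ?enum_uniq //.
  by rewrite cardE.
by rewrite -(image_eq bf); apply: finite_image.
Qed.

Definition dim_sets (I : finType) m (v : I -> 'rV[R]_m) k : {set {set I}} :=
  [set T : {set I} | `[< exposed v [set: I]%SET T /\ has_dim (hull v T) k >]]%SET.

Lemma face_numE (I : finType) m (v : I -> 'rV[R]_m) k :
  face_num k (hull v [set: I]%SET) = #|dim_sets v k| /\
  finite_set [set F | faces (hull v [set: I]%SET) F /\ has_dim F k].
Proof.
apply: (@card_image_finset _ _ _ (hull v)).
  move=> S T; rewrite !finset.inE => /asboolP[eS _] /asboolP[eT _] h.
  exact: exposed_hull_inj eS eT h.
move=> F; split=> [[/facesP [T eT ->] hT]|[T]].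
  by exists T => //; rewrite inE; apply/asboolP.
by rewrite inE => /asboolP[eT hT] ->; split=> //; apply/facesP; exists T.
Qed.

Lemma finite_faces m (P : set 'rV[R]_m) k :
  is_polytope P -> finite_set [set F | faces P F /\ has_dim F k].
Proof. by case/polytope_hull=> N [v ->]; have [] := face_numE v k. Qed.

Lemma comb_equiv_face_num m n (P : set 'rV[R]_m) (Q : set 'rV[R]_n) :
  is_polytope P -> is_polytope Q -> comb_equiv (faces P) (faces Q) ->
  (forall d, has_dim P d <-> has_dim Q d) /\ forall k, face_num k P = face_num k Q.
Proof.
move=> pP pQ [phi [bphi po]]; have H := comb_equiv_dim pP pQ bphi po.
have [ph iP sP] := bphi.
split=> [d|k].
  suff <- : phi P = Q by apply: H; apply: face_refl.
  apply/seteqP; split; first by apply: face_subset; apply/ph/face_refl.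
  have [F fF <-] := sP Q (face_refl Q).
  by apply/po => //; [apply: face_refl | apply: face_subset].
apply: (card_fset_bij (f := phi)) (finite_faces k pP) _.
split=> [F [fF hF]|F G|G [fG hG]] /=.
- by split; [apply: ph | apply/H].
- by rewrite !in_setE => -[fF _] [fG _]; apply: iP; rewrite in_setE.
- by have [F fF e] := sP G fG; exists F => //; split=> //; apply/H => //; rewrite e.
Qed.

(** An isomorphism of 1-skeletons only sees inclusions, so edges are singled out as the members that
    have a smaller nonempty member. *)
Definition edge_like m (X : set (set 'rV[R]_m)) : set (set 'rV[R]_m) :=
  [set F | X F /\ exists2 G, X G & [/\ G !=set0, G `<=` F & G <> F]].

Lemma edge_like_skeleton m (P : set 'rV[R]_m) : is_polytope P ->
  edge_like (skeleton 1 P) = [set F | faces P F /\ has_dim F 1].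
Proof.
move=> pP; apply/seteqP; split=> F.
  move=> [[fF F01] [G [fG G01] [G0 GF nGF]]].
  case: F01 => [F0|[i i1 hi]].
    by move: G0 => [x /GF]; rewrite F0.
  split=> //; have [k hk] := polytope_dim (face_polytope pP fG) G0.
  have : (k < i)%N.
    apply: (proper_face_dim (face_polytope pP fF) _ nGF hi hk).
    by apply/(facesE _ pP fF).
  by case: i i1 hi => [|[|]].
move=> [fF hF]; split; first by split=> //; right; exists 1%N.
have [G fG hG] := facet_exists (face_polytope pP fF) hF.
have [fPG GF] := (facesE G pP fF).1 fG.
exists G; first by split=> //; right; exists 0%N.
split=> //; first exact: has_dim_nonempty hG.
by move=> e; move: hF; rewrite -e => /(has_dim_inj hG).
Qed.

Lemma skeleton1_face_num m n (P : set 'rV[R]_m) (Q : set 'rV[R]_n) :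
  is_polytope P -> is_polytope Q -> comb_equiv (skeleton 1 P) (skeleton 1 Q) ->
  face_num 1 P = face_num 1 Q.
Proof.
move=> pP pQ [phi [bphi po]]; have [ph iP sP] := bphi.
have [psi [h1 h2 h3]] := bij_inverse bphi.
have s0 k (A : set 'rV[R]_k) : skeleton 1 A set0 by split; [apply: face_set0 | left].
have e0 : phi set0 = set0.
  by rewrite -subset0 -(h2 _ (s0 _ Q)); apply/po => //; apply: h1.
rewrite /face_num -edge_like_skeleton // -[in RHS]edge_like_skeleton //.
apply: (card_fset_bij (f := phi)).
  by rewrite edge_like_skeleton //; apply: finite_faces.
have ne F : skeleton 1 P F -> F !=set0 <-> phi F !=set0.
  move=> fF; split=> -[x xF]; apply/set0P/eqP => e.
    have : phi F `<=` phi set0 by rewrite e.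
    by move/(po _ _ fF (s0 _ _)) => /(_ x xF).
  by move: xF; rewrite e e0.
split=> [F [fF [G fG [G0 GF nGF]]]|F G|F [fF [G fG [G0 GF nGF]]]] /=.
- split; [exact: ph | exists (phi G); first exact: ph].
  split; [by apply/ne | by apply/po |].
  by move=> e; apply: nGF; apply: iP; rewrite ?in_setE.
- by rewrite !in_setE => -[fF _] [fG _]; apply: iP; rewrite in_setE.
- exists (psi F); last exact: h2.
  split; [exact: h1 | exists (psi G); first exact: h1].
  split; first by apply/ne; rewrite ?h2 //; apply: h1.
    by apply/po; rewrite ?h2 //; apply: h1.
  by move=> /(congr1 phi); rewrite !h2.
Qed.

End Polytopes.

(** * Cubes *)

Section Cubes.
Context {R : realType}.

Definition signs n := {ffun 'I_n -> bool}.

(** This is the vertex set of the face of the cube through [s] with directions [T]. Sign vectors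
    that differ only on [T] give the same face. *)
Definition subcube n (T : {set 'I_n}) (s : signs n) : {set signs n} :=
  [set s' : signs n | [forall k, (k \in T) || (s' k == s k)]]%SET.

Lemma in_subcube n (T : {set 'I_n}) (s s' : signs n) :
  reflect (forall k, k \notin T -> s' k = s k) (s' \in subcube T s).
Proof.
rewrite inE; apply: (iffP forallP) => h k; have := h k.
  by case: (k \in T) => //= /eqP.
by case: (k \in T) => //= /(_ isT) ->.
Qed.

Lemma subcube_refl n (T : {set 'I_n}) (s : signs n) : s \in subcube T s.
Proof. exact/in_subcube. Qed.

Lemma subcube_setT n (s : signs n) : subcube finset.setT s = finset.setT.
Proof.
apply/setP => s'; rewrite finset.in_setT; apply/in_subcube => k.
by rewrite finset.in_setT.
Qed.

Definition flip n (s : signs n) k : signs n := [ffun i => if i == k then ~~ s i else s i].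

Lemma flip_subcube n (T : {set 'I_n}) (s s' : signs n) k :
  s' \in subcube T s -> (flip s' k \in subcube T s) = (k \in T).
Proof.
move=> /in_subcube h; apply/in_subcube/idP => [h'|kT i iT].
  apply: contraT => kT; have := h' k kT; rewrite ffunE eqxx (h k kT).
  by case: (s k).
by rewrite ffunE; case: eqP iT => [->|_ /h //]; rewrite kT.
Qed.

Lemma subcube_eq n (T T' : {set 'I_n}) (s s' : signs n) :
  subcube T s = subcube T' s' -> T = T' /\ forall k, k \notin T -> s k = s' k.
Proof.
move=> e; have sS : s \in subcube T' s' by rewrite -e subcube_refl.
have TT : T = T'.
  by apply/setP => k; rewrite -(flip_subcube _ (subcube_refl T s)) e flip_subcube.
by split=> // k kT; move/in_subcube: sS => -> //; rewrite -TT.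
Qed.

(** Requiring [s] to be false on the free directions picks one label for each [d]-face, so that
    faces can be counted. *)
Definition patterns n d : {set {set 'I_n} * signs n} :=
  [set p : {set 'I_n} * signs n | (#|p.1| == d) && [forall k in p.1, ~~ p.2 k]]%SET.

Lemma card_patterns n d : #|patterns n d| = ('C(n, d) * 2 ^ (n - d))%N.
Proof.
rewrite -sum1_card.
rewrite (eq_bigl (fun p : {set 'I_n} * signs n =>
  (#|p.1| == d) && [forall k in p.1, ~~ p.2 k])); last by move=> p; rewrite inE.
rewrite -(pair_big_dep (fun T : {set 'I_n} => #|T| == d)
  (fun T (s : signs n) => [forall k in T, ~~ s k]) (fun _ _ => 1%N)) /=.
transitivity (\sum_(T : {set 'I_n} | #|T| == d) 2 ^ (n - d))%N.
  apply: eq_bigr => T /eqP Td; rewrite sum1_card.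
  have <- : #|pffun_on false (~: T) (@predT bool)| = (2 ^ (n - d))%N.
    by rewrite card_pffun_on cardsCs finset.setCK card_ord Td; congr (_ ^ _)%N; rewrite card_bool.
  apply: eq_card => s; rewrite [LHS]unfold_in; apply/forallP/pffun_onP => [h|[h _] k].
    split=> // ; apply/fintype.subsetP => k; rewrite unfold_in eqbF_neg negbK inE.
    by move=> sk; apply: contraL sk => kT; have := h k; rewrite kT.
  apply/implyP => kT; apply: contraL kT => sk.
  have /fintype.subsetP /(_ k) := h; rewrite unfold_in eqbF_neg negbK sk inE.
  by apply.
rewrite sum_nat_const -[in RHS](card_ord n) -card_draws card_ord.
by congr (_ * _)%N; apply: eq_card => T; rewrite inE.
Qed.

Lemma subcube_inj n d :
  {in patterns n d &, injective (fun p : {set 'I_n} * signs n => subcube p.1 p.2)}.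
Proof.
move=> [T s] [T' s']; rewrite !inE /= => /andP[_ /forallP h] /andP[_ /forallP h'].
case/subcube_eq => TT hs; congr pair => //; apply/ffunP => k.
have [kT|/hs //] := boolP (k \in T).
have := h k; have := h' k; rewrite -TT kT /=.
by case: (s k); case: (s' k).
Qed.

Lemma patterns_subcube n (T : {set 'I_n}) (s : signs n) :
  exists2 p, p \in patterns n #|T| & subcube T s = subcube p.1 p.2.
Proof.
exists (T, [ffun k => if k \in T then false else s k]).
  by rewrite inE eqxx /=; apply/forallP => k; rewrite ffunE; case: (k \in T).
apply/setP => s'; apply/in_subcube/in_subcube => /= h k kT.
  by rewrite ffunE (negPf kT) h.
by rewrite h // ffunE (negPf kT).
Qed.

Definition cube_like n m (u : signs n -> 'rV[R]_m) : Prop :=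
  forall S, exposed u finset.setT S <->
    (S = finset.set0 \/ exists T s, S = subcube T s).

(** In the first hypothesis the bound is attained, at [s] itself. A valid inequality with the same
    functional and another right-hand side is therefore tight nowhere and exposes the empty set. *)
Lemma cube_like_intro n m (u : signs n -> 'rV[R]_m) :
  (forall c, exists b T s, forall s', dot c (u s') <= b ?= iff (s' \in subcube T s)) ->
  (forall T s, exists c b, forall s', dot c (u s') <= b ?= iff (s' \in subcube T s)) ->
  cube_like u.
Proof.
move=> h1 h2 S; split=> [[c [b [cb ->]]]|[->|[T [s ->]]]]; last 2 first.
- exact: exposed_set0.
- have [c [b h]] := h2 T s; exists c, b; split=> [s' _|]; first exact: (h s').1.
  by apply/setP => s'; rewrite !inE /= (h s').2 inE.
have [b0 [T [s h]]] := h1 c.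
have [e|nb] := eqVneq b b0.
  right; exists T, s; apply/setP => s'.
  by rewrite [LHS]inE finset.in_setT e (h s').2.
left; apply/setP => s'; rewrite !inE; apply/negP => /eqP e.
have := cb s (finset.in_setT _); have [_ /eqP hs] := h s.
have := (h s).2; rewrite subcube_refl => /eqP ->.
have := (h s').1; rewrite e => bb0 b0b; case/negP: nb; apply/eqP/le_anti.
by rewrite bb0 b0b.
Qed.

Definition cube_vertex n (s : signs n) : 'rV[R]_n := \row_i (s i)%:R.

Lemma dot_cube_vertex n (c : 'cV[R]_n) (s : signs n) :
  dot c (cube_vertex s) = \sum_i (s i)%:R * c i 0.
Proof. by rewrite /dot mxE; apply: eq_bigr => i _; rewrite mxE. Qed.

Lemma leif_sum_subcube n (f : bool -> 'I_n -> R) (T : {set 'I_n}) (s : signs n) :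
  (forall k b, f b k <= f (s k) k ?= iff (k \in T) || (b == s k)) ->
  forall s' : signs n, \sum_k f (s' k) k <= \sum_k f (s k) k ?= iff (s' \in subcube T s).
Proof.
by move=> h s'; rewrite inE; apply: leif_sum => k _; apply: h.
Qed.

Lemma cube_like_cube n : cube_like (@cube_vertex n).
Proof.
apply: cube_like_intro => [c|T s].
  pose s : signs n := [ffun i => 0 < c i 0]; pose T := [set i | c i 0 == 0]%SET.
  exists (dot c (cube_vertex s)), T, s => s'; rewrite !dot_cube_vertex.
  apply: (@leif_sum_subcube _ (fun b i => b%:R * c i 0)) => k b; rewrite inE ffunE.
  have [c0|c0|->] := ltgtP (c k 0) 0; last by rewrite !mulr0; apply/leif_refl.
    case: b; rewrite ?mul1r ?mul0r /=; last exact/leif_refl.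
    by split; [exact: ltW | rewrite lt_eqF].
  case: b; rewrite ?mul1r ?mul0r /=; first exact/leif_refl.
  by split; [exact: ltW | rewrite lt_eqF].
pose c : 'cV[R]_n := \col_i (if i \in T then 0 else if s i then 1 else -1).
exists c, (dot c (cube_vertex s)) => s'; rewrite !dot_cube_vertex.
apply: (@leif_sum_subcube _ (fun b i => b%:R * c i 0)) => k b; rewrite mxE.
case: (k \in T) => /=; first by rewrite !mulr0; apply/leif_refl.
by case: (s k); case: b; rewrite ?mul1r ?mul0r /=; try exact/leif_refl;
  split; rewrite ?ler01 ?lerN10 // ?oppr_eq0 ?[0 == 1]eq_sym oner_eq0.
Qed.

Lemma cube_hull n : @cube R n = hull (@cube_vertex n) finset.setT.
Proof.
apply/seteqP; split=> x; last first.
  case=> w [w0 _ w1 ->] i; rewrite summxE.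
  under eq_bigr => s _ do rewrite !mxE.
  rewrite sumr_ge0 /= => [|s _]; last by rewrite mulr_ge0 // ler0n.
  rewrite -[X in _ <= X]w1 ler_sum // => s _; rewrite ler_piMr //.
  by case: (s i); rewrite ?lexx ?ler01.
move=> x01.
(* The weights form the product distribution on sign vectors whose [i]-th marginal is true with
   probability [x 0 i]. *)
pose F i (b : bool) := if b then x 0 i else 1 - x 0 i.
have F0 i b : 0 <= F i b by have /andP[] := x01 i; case: b => /=; lra.
have FS i : \sum_b F i b = 1 by rewrite big_bool /F /=; ring.
exists (fun s : signs n => \prod_i F i (s i)); split=> [s|s|| ].
- exact: prodr_ge0.
- by rewrite finset.in_setT.
- rewrite -bigA_distr_bigA /=; under eq_bigr => i _ do rewrite FS.
  by rewrite big1.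
apply/rowP => j; rewrite summxE.
transitivity (\sum_(s : signs n) \prod_i (if i == j then (s i)%:R * F i (s i) else F i (s i))).
  rewrite -(bigA_distr_bigA (fun i (b : bool) => if i == j then b%:R * F i b else F i b)) /=.
  rewrite (bigD1 j) //= eqxx big_bool /= mul1r mul0r addr0 big1 ?mulr1 //.
  by move=> i /negPf ->; rewrite FS.
apply: eq_bigr => s _; rewrite !mxE (bigD1 j) //= eqxx [in RHS](bigD1 j) //=.
rewrite [RHS]mulrAC [X in X * _ = _]mulrC; congr (_ * _).
by apply: eq_bigr => i /negPf ->.
Qed.

Lemma cube_polytope n : is_polytope (@cube R n).
Proof. rewrite cube_hull; exact: hull_polytope. Qed.

Lemma cube_vertexB n (T : {set 'I_n}) (s s' : signs n) :
  s' \in subcube T s ->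
  cube_vertex s' - cube_vertex s = \sum_(i in T) ((s' i)%:R - (s i)%:R) *: delta_mx 0 i.
Proof.
move=> /in_subcube h; apply/rowP => j; rewrite summxE !mxE.
under eq_bigr => i _ do rewrite !mxE eqxx /=.
have [jT|jT] := boolP (j \in T).
  rewrite (bigD1 j) //= eqxx mulr1 big1 ?addr0 // => i /andP[_ ij].
  by rewrite eq_sym (negPf ij) mulr0.
rewrite h // subrr big1 // => i iT; case: eqP iT jT => [->|_ _ _]; last by rewrite mulr0.
by move=> ->.
Qed.

Lemma subcube_has_dim n (T : {set 'I_n}) (s : signs n) :
  has_dim (hull (@cube_vertex n) (subcube T s)) #|T|.
Proof.
(* From the vertex that is 0 on [T], adding a unit vector with direction in [T] leads to another
   vertex of the face. *)
pose s0 : signs n := [ffun i => if i \in T then false else s i].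
have -> : subcube T s = subcube T s0.
  apply/setP => s'; apply/in_subcube/in_subcube => h k kT.
    by rewrite ffunE (negPf kT) h.
  by rewrite h // ffunE (negPf kT).
pose B : 'M[R]_(#|T|, n) := \matrix_k delta_mx 0 (enum_val k).
have subB i : i \in T -> ((delta_mx 0 i : 'rV[R]_n) <= B)%MS.
  move=> iT; have := row_sub (enum_rank_in iT i) B.
  by rewrite rowK enum_rankK_in.
exists (cube_vertex s0), B; split.
- exact/hull_vertex/subcube_refl.
- apply/row_freeP; exists B^T; apply/matrixP => i j.
  rewrite !mxE (bigD1 (enum_val i)) //= !mxE !eqxx mul1r big1 ?addr0.
    by rewrite (inj_eq enum_val_inj) eq_sym.
  by move=> k /negPf ki; rewrite !mxE ki andbF mul0r.
- move=> i; rewrite rowK.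
  have fS : flip s0 (enum_val i) \in subcube T s0.
    by rewrite flip_subcube ?subcube_refl // enum_valP.
  suff -> : cube_vertex s0 + delta_mx 0 (enum_val i) = cube_vertex (flip s0 (enum_val i)).
    exact: hull_vertex.
  apply/rowP => j; rewrite !mxE !ffunE eqxx /=.
  case: eqP => [->|_]; last by rewrite addr0.
  by rewrite enum_valP add0r.
- move=> x [w [w0 wT w1 ->]].
  have -> : \sum_i w i *: cube_vertex i - cube_vertex s0
      = \sum_i w i *: (cube_vertex i - cube_vertex s0).
    rewrite -[X in _ - X]scale1r -w1 scaler_suml -sumrB.
    by apply: eq_bigr => i _; rewrite scalerBr.
  apply: summx_sub => i _; have [iT|/wT ->] := boolP (i \in subcube T s0); last first.
    by rewrite scale0r sub0mx.
  apply: scalemx_sub; rewrite (cube_vertexB iT); apply: summx_sub => j jT.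
  by apply: scalemx_sub; apply: subB.
Qed.

Lemma cube_has_dim n : has_dim (@cube R n) n.
Proof.
have := subcube_has_dim finset.setT ([ffun => false] : signs n).
by rewrite subcube_setT -cube_hull cardsT card_ord.
Qed.

Lemma cube_face_num n d : face_num d (@cube R n) = ('C(n, d) * 2 ^ (n - d))%N.
Proof.
rewrite cube_hull; have [-> _] := face_numE (@cube_vertex n) d.
rewrite -card_patterns -(card_in_imset (@subcube_inj n d)).
apply: eq_card => S; rewrite inE; apply/asboolP/imsetP => [[eS hS]|[[T s]]].
  case: ((cube_like_cube S).1 eS) => [S0|[T [s e]]].
    by have := has_dim_hull_neq0 hS; rewrite S0 eqxx.
  have [p pP ep] := patterns_subcube T s; exists p; rewrite ?e //.
  by rewrite e in hS; rewrite (has_dim_inj hS (subcube_has_dim T s)).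
rewrite inE /= => /andP[/eqP <- _] ->; split; last exact: subcube_has_dim.
by apply/cube_like_cube; right; exists T, s.
Qed.

End Cubes.

(** * Cubical 4-polytopes *)

Section Cubical.
Context {R : realType}.

Lemma realized_face_space p N (L : 'M[R]_(p, N)) (T J : {set 'I_N}) :
  realized (face_space L T) J = realized L J && (T \subset J).
Proof.
apply/realizedP/andP => [[z [zF z0 m1] <-]|[/realizedP[z [zL z0 m1] zJ] TJ]].
  move: zF; rewrite sub_face_space => /andP[zL Tz]; split=> //.
  by apply/realizedP; exists z.
by exists z => //; split=> //; rewrite sub_face_space zL zJ.
Qed.

Lemma rank_face_face p N (L : 'M[R]_(p, N)) (T J : {set 'I_N}) : T \subset J ->
  \rank (face_space (face_space L T) J) = \rank (face_space L J).
Proof.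
move=> TJ; apply/eqmx_rank/rV_eqP => z; rewrite !sub_face_space.
have [Jz|_] := boolP (J \subset zset z); last by rewrite !andbF.
by rewrite (fintype.subset_trans TJ Jz) !andbT.
Qed.

Lemma rank_face_proper p N (L : 'M[R]_(p, N)) (T J : {set 'I_N}) :
  realized L T -> T \proper J -> (\rank (face_space L J) < \rank (face_space L T))%N.
Proof.
move=> /realizedP[z bz zT] /properP[TJ [i iJ iT]].
rewrite (ltn_leqif (mxrank_leqif_sup (face_space_le _ TJ))).
apply: contra iT => FF; have zF : (z <= face_space L T)%MS.
  by apply: base_point_face; rewrite ?zT.
have := submx_trans zF FF; rewrite sub_face_space => /andP[_ /fintype.subsetP /(_ i iJ)].
by rewrite zT.
Qed.

(** Computed at a single point [v i]: its hull has dimension 0, so its face space has rank [d] by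
    [face_rank], and restricting the slack vectors to it leaves rank 1. *)
Lemma rank_slacks m N (v : 'I_N -> 'rV[R]_m) d :
  has_dim (hull v finset.setT) d ->
  \rank (face_space (slacks v) finset.set0) = d.+1.
Proof.
move=> hd; have /set0Pn [i iT] := has_dim_hull_neq0 hd.
have i1 : i \in [set i]%SET by rewrite !inE.
have [k hk rk] := hull_has_dim v i1.
have k0 : k = 0%N.
  apply: (has_dim_inj hk); exists (v i), 0; split.
  - exact: hull_vertex.
  - by rewrite /row_free mxrank0.
  - by case.
  - move=> x [w [w0 wT w1 ->]].
    suff -> : \sum_i w i *: v i = v i by rewrite subrr sub0mx.
    have wi : w i = 1.
      rewrite -w1 (bigD1 i) //= big1 ?addr0 // => j ji.
      by rewrite wT // inE.
    rewrite (bigD1 i) //= big1 ?addr0 => [|j ji]; first by rewrite wi scale1r.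
    by rewrite wT ?inE // scale0r.
have n0 : [set i]%SET != finset.set0 by apply/set0Pn; exists i.
have := (face_rank 0 hd n0).1; rewrite -{1}k0 => /(_ hk); rewrite add0n => hr.
have := rank_face_space (slacks v) [set i]%SET; rewrite rk hr k0.
by rewrite rank_face_set0 => <-.
Qed.

Lemma realized_rank_le m N (v : 'I_N -> 'rV[R]_m) (T : {set 'I_N}) d :
  has_dim (hull v finset.setT) d -> T != finset.set0 -> realized (slacks v) T ->
  (0 < \rank (face_space (slacks v) T) <= d)%N.
Proof.
move=> hd T0 rT; have /realizedP [z bz zT] := rT.
rewrite -[X in (0 < \rank (face_space _ X))%N]zT rank_base_point //=.
rewrite -ltnS -(rank_slacks hd); apply: rank_face_proper.
  by have /set0Pn [i _] := has_dim_hull_neq0 hd; apply: realized_set0 i.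
by rewrite finset.proper0.
Qed.

(** The full index set, exposed but not realized, is excluded by [k < d]; the empty set is excluded
    because its face space has rank [d + 1]. *)
Lemma in_dim_sets m N (v : 'I_N -> 'rV[R]_m) (T : {set 'I_N}) d k :
  has_dim (hull v finset.setT) d -> (k < d)%N ->
  (T \in dim_sets v k) =
  realized (slacks v) T && (k + \rank (face_space (slacks v) T) == d)%N.
Proof.
move=> hd kd; rewrite inE; apply/asboolP/andP => [[eT hT]|[rT /eqP r]].
  have T0 := has_dim_hull_neq0 hT.
  split; last by apply/eqP/(face_rank k hd T0).
  have [e|//] := (exposed_realized _ _).1 eT.
  by move: kd; rewrite e in hT; rewrite (has_dim_inj hT hd) ltnn.
have T0 : T != finset.set0.
  by apply: contra_eq_neq r => ->; rewrite (rank_slacks hd); lia.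
by split; [apply/exposed_realized; right | apply/(face_rank k hd T0)].
Qed.

Lemma sumN1_eq (I : finType) (A : pred I) :
  \sum_(i | A i) (-1 : int) = - (#|[set i | A i]%SET|)%:R.
Proof. by rewrite sumrN sumr_const cardsE. Qed.

(** A [k]-face corresponds to rank [4 - k]. The empty set has rank 5 and contributes -1, which
    cancels the value -1 of the characteristic of the whole cone. *)
Theorem euler_polytope4 m N (v : 'I_N -> 'rV[R]_m) : has_dim (hull v finset.setT) 4 ->
  (#|dim_sets v 0| + #|dim_sets v 2| = #|dim_sets v 1| + #|dim_sets v 3|)%N.
Proof.
move=> hd; have /set0Pn [i iT] := has_dim_hull_neq0 hd.
have r0 := realized_set0 v i; have /realizedP [z bz _] := r0.
have := euler_cone bz; rewrite /euler_char (bigD1 finset.set0) //=.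
rewrite (rank_slacks hd).
have E J : realized (slacks v) J && (J != finset.set0) ->
   (-1) ^+ \rank (face_space (slacks v) J) =
   (J \in dim_sets v 0)%:R - (J \in dim_sets v 1)%:R +
   (J \in dim_sets v 2)%:R - (J \in dim_sets v 3)%:R :> int.
  move=> /andP[rJ J0]; rewrite !(in_dim_sets _ hd) // rJ /=.
  have := realized_rank_le hd J0 rJ.
  by case: (\rank _) => [|[|[|[|[|]]]]].
rewrite (eq_bigr _ E) !(sumrB, big_split) /=.
have S k : (k < 4)%N -> \sum_(J | realized (slacks v) J && (J != finset.set0))
    (J \in dim_sets v k)%:R = (#|dim_sets v k|)%:R :> int.
  move=> k4; rewrite -natr_sum; congr (_%:R).
  rewrite -sum1_card [RHS]big_mkcond [LHS]big_mkcond /=; apply: eq_bigr => J _.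
  have [JD|_] := boolP (J \in dim_sets v k); last by rewrite if_same.
  move: (JD); rewrite (in_dim_sets _ hd k4) => /andP[-> _].
  by move: JD; rewrite inE => /asboolP[_ /has_dim_hull_neq0 ->].
rewrite !S // (_ : (-1) ^+ 5 = -1 :> int) // !natz.
by move: #|_| #|_| #|_| #|_| => a b c d; lia.
Qed.

(** In the rank 2 cone [face_space (slacks v) T] the set [T] contributes 1 and each facet containing
    the ridge contributes -1. As the sum is -1, there are two such facets. *)
Lemma ridge_in_two_facets m N (v : 'I_N -> 'rV[R]_m) d T :
  has_dim (hull v finset.setT) d.+2 -> T \in dim_sets v d ->
  #|[set F in dim_sets v d.+1 | T \subset F]%SET| = 2%N.
Proof.
move=> hd; rewrite (in_dim_sets _ hd) // => /andP[rT /eqP].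
rewrite -[X in _ = X]addn2 => /addnI r2.
have rFT : realized (face_space (slacks v) T) T by rewrite realized_face_space rT subxx.
have /realizedP [z bz _] := rFT; have := euler_cone bz.
rewrite /euler_char (bigD1 T) //= rank_face_face // r2 expr2 mulN1r opprK.
rewrite (eq_bigr (fun _ => -1)) => [|J]; last first.
  rewrite realized_face_space => /andP[/andP[rJ TJ] nJ]; rewrite rank_face_face //.
  have pJ : T \proper J by rewrite finset.properEneq eq_sym nJ.
  have := rank_face_proper rT pJ; rewrite r2.
  have /realizedP [y by_ yJ] := rJ; have := rank_base_point by_; rewrite yJ.
  by case: (\rank _) => [|[|]].
rewrite sumN1_eq natz => e.
suff -> : [set F in dim_sets v d.+1 | T \subset F]%SET =
  [set J | realized (face_space (slacks v) T) J && (J != T)]%SET.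
  by move: e; move: #|_| => a; lia.
apply/setP => J; rewrite [RHS]inE realized_face_space.
have -> : (J \in [set F in dim_sets v d.+1 | T \subset F]%SET) =
  (J \in dim_sets v d.+1) && (T \subset J).
  by rewrite finset.setIdE finset.in_setI; congr (_ && _); rewrite inE.
rewrite (in_dim_sets _ hd) //.
have [rJ|//] := boolP (realized (slacks v) J).
rewrite addSnnS -[X in _ == X]addn2 eqn_add2l eqSS /= andbC.
have [TJ|//] := boolP (T \subset J); rewrite /=.
apply/eqP/idP => [r1|nJ].
  by apply: contra_eq_neq r1 => ->; rewrite r2.
have pJ : T \proper J by rewrite finset.properEneq eq_sym nJ.
have := rank_face_proper rT pJ; rewrite r2.
have /realizedP [y by_ yJ] := rJ; have := rank_base_point by_; rewrite yJ.
by case: (\rank _) => [|[|]].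
Qed.

Lemma cubical_facet m N (v : 'I_N -> 'rV[R]_m) F :
  cubical_polytope 4 (hull v finset.setT) -> F \in dim_sets v 3 ->
  #|[set T in dim_sets v 2 | T \subset F]%SET| = 6%N.
Proof.
case=> pP hP cP; rewrite inE => /asboolP[eF hF].
have fF : faces (hull v finset.setT) (hull v F) by apply/facesP; exists F.
have [pF [k cF]] : comb_cube (hull v F).
  apply: cP => //; first exact: has_dim_nonempty hF.
  by move=> e; rewrite e in hF; have := has_dim_inj hF hP.
have [hd fn] := comb_equiv_face_num pF (cube_polytope k) cF.
have k3 : k = 3%N by apply: has_dim_inj (cube_has_dim k) _; apply/hd.
have <- : face_num 2 (hull v F) = 6%N by rewrite fn k3 cube_face_num.
apply/esym; apply: (proj1 (card_image_finset (f := hull v) _ _)).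
  move=> S T; rewrite !inE => /andP[/asboolP[eS _] _] /andP[/asboolP[eT _] _].
  exact: exposed_hull_inj eS eT.
move=> G; rewrite /= (faces_of_face G eF) facesP; split.
  move=> [[[T eT ->] TF] hT]; exists T => //; rewrite !inE.
  by apply/andP; split; [apply/asboolP | apply/(exposed_hull_sub (exposed_sub eT) eF)].
move=> [T + ->]; rewrite !inE => /andP[/asboolP[eT hT] TF].
by split=> //; split; [exists T | apply: hull_sub].
Qed.

(** Counting incidences of 2-faces with facets gives [2 f2 = 6 f3]; substituting [f2 = 3 f3] in the
    Euler relation eliminates the 2-faces. *)
Theorem cubical4_face_num m (P : set 'rV[R]_m) : cubical_polytope 4 P ->
  (2 * face_num 3 P + face_num 0 P = face_num 1 P)%N.
Proof.
move=> cP; have [pP hP _] := cP; have [N [v eP]] := polytope_hull pP; subst P.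
have := euler_polytope4 hP; have fn k := proj1 (face_numE v k); rewrite -!fn.
have : (2 * face_num 2 (hull v finset.setT) = 6 * face_num 3 (hull v finset.setT))%N.
  rewrite !fn -!sum1_card !big_distrr /= !muln1.
  transitivity (\sum_(T in dim_sets v 2) \sum_(F in dim_sets v 3 | T \subset F) 1)%N.
    apply: eq_bigr => T T2; rewrite sum1_card.
    apply: etrans (esym (ridge_in_two_facets hP T2)) _.
    by apply: eq_card => F; rewrite inE.
  rewrite (exchange_big_dep (mem (dim_sets v 3))) /=; last by move=> T F _ /andP[].
  apply: eq_bigr => F F3; rewrite F3 /=.
  rewrite sum1_card; apply: etrans _ (cubical_facet cP F3).
  by apply: eq_card => T; rewrite inE.
by move: (face_num 0 _) (face_num 1 _) (face_num 2 _) (face_num 3 _) => a b c d; lia.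
Qed.

(** The graph of the [n]-cube gives [f1 = n 2^(n-1)], so
    [2 f3 = n 2^(n-1) - 2^n = (n - 2) 2^(n-1)]. *)
Theorem neighborly_face_num m (P : set 'rV[R]_m) n : neighborly_cubical 4 P ->
  face_num 0 P = (2 ^ n)%N -> (4 <= n)%N /\ face_num 3 P = ((n - 2) * 2 ^ (n - 2))%N.
Proof.
move=> [cP [n' [n4 f0 sk]]] f0'; have nn : n' = n.
  by apply/eqP; rewrite -(eqn_exp2l (m := 2)) // -f0 f0'.
subst n'; split=> //; have [pP _ _] := cP.
have := skeleton1_face_num pP (cube_polytope n) sk.
rewrite cube_face_num bin1 => f1; have := cubical4_face_num cP.
rewrite f1 f0; have -> : (2 ^ n = 4 * 2 ^ (n - 2))%N.
  by rewrite -[4%N]/(2 ^ 2)%N -expnD subnKC // (leq_trans _ n4).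
have -> : (2 ^ (n - 1) = 2 * 2 ^ (n - 2))%N.
  by rewrite -expnS; congr (_ ^ _)%N; lia.
rewrite mulnBl; lia.
Qed.

End Cubical.

(** * Deformed cubes *)

Section SignedSystems.
Context {R : realType}.

Definition sg (b : bool) : R := if b then 1 else -1.

Lemma sgK b x : sg b * (sg b * x) = x.
Proof. by case: b; rewrite /sg; ring. Qed.

(** The sign [s k] selects which inequality of the [k]-th pair is tight; the vertex of the deformed
    cube labelled [s] solves the resulting system. *)
Definition signed_mx n (e : R) (M : 'M[R]_n) (s : signs n) : 'M[R]_n :=
  diag_mx (\row_k (e * sg (s k))) + M.

Definition strictly_lower n (M : 'M[R]_n) : Prop :=
  forall k j : 'I_n, (k <= j)%N -> M k j = 0.

Lemma signed_mx_col n e (M : 'M[R]_n) s (x : 'cV[R]_n) k :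
  (signed_mx e M s *m x) k 0 = e * sg (s k) * x k 0 + \sum_j M k j * x j 0.
Proof. by rewrite mulmxDl mxE mul_diag_mx !mxE. Qed.

Lemma row_signed_mx n e (M : 'M[R]_n) s (l : 'rV[R]_n) j :
  (l *m signed_mx e M s) 0 j = e * sg (s j) * l 0 j + \sum_k l 0 k * M k j.
Proof. by rewrite mulmxDr mxE mul_mx_diag !mxE [l 0 j * _]mulrC. Qed.

Lemma signed_mx_unit n e (M : 'M[R]_n) s :
  e != 0 -> strictly_lower M -> signed_mx e M s \in unitmx.
Proof.
move=> e0 lM; have tr : is_trig_mx (signed_mx e M s).
  apply/is_trig_mxP => i j ij; rewrite !mxE lM ?(ltnW ij) // addr0.
  by case: eqP ij => [->|_ _]; rewrite ?ltnn ?mulr0n.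
rewrite unitmxE unitfE (det_trig tr); apply/prodf_neq0 => i _.
rewrite !mxE eqxx mulr1n lM // addr0 mulf_neq0 // /sg.
by case: (s i); rewrite ?oppr_eq0 oner_eq0.
Qed.

(* The right-hand sides are chosen one after the other, each dominating the
   contribution of the previous coordinates. *)
Lemma exists_sign_vertices n e (M : 'M[R]_n) : 0 < e -> strictly_lower M ->
  exists (b : 'cV[R]_n) (x : signs n -> 'cV[R]_n), forall s,
    signed_mx e M s *m x s = b /\ forall k, 0 < sg (s k) * x s k 0.
Proof.
move=> e0 lM.
suff H i : (i <= n)%N -> exists (b : 'cV[R]_n) (x : signs n -> 'cV[R]_n),
    forall s (k : 'I_n), (k < i)%N ->
    (signed_mx e M s *m x s) k 0 = b k 0 /\ 0 < sg (s k) * x s k 0.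
  have [b [x h]] := H n (leqnn n); exists b, x => s; split=> [|k].
    by apply/colP => k; have [] := h s k (ltn_ord k).
  by have [] := h s k (ltn_ord k).
elim: i => [_|i IH i_n]; first by exists 0, (fun=> 0).
have [b [x h]] := IH (ltnW i_n); pose i0 := Ordinal i_n.
pose g (s : signs n) := \sum_j M i0 j * x s j 0; pose bi := 1 + \sum_s `|g s|.
have gb s : 0 < bi - g s.
  rewrite /bi (bigD1 s) //=; have := ler_norm (g s).
  have : 0 <= \sum_(s' | s' != s) `|g s'| by apply: sumr_ge0.
  lra.
pose b' : 'cV[R]_n := \col_k (if k == i0 then bi else b k 0).
pose x' (s : signs n) : 'cV[R]_n :=
  \col_k (if k == i0 then sg (s i0) * ((bi - g s) / e) else x s k 0).
have low s (k : 'I_n) : (k <= i)%N ->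
    \sum_j M k j * x' s j 0 = \sum_j M k j * x s j 0.
  move=> ki; apply: eq_bigr => j _; rewrite !mxE; case: eqP => // ->.
  by rewrite lM ?mul0r.
exists b', x' => s k; rewrite ltnS => ki; rewrite signed_mx_col low // !mxE.
have [->|nk] := eqVneq k i0.
  rewrite sgK; split; last by rewrite divr_gt0.
  rewrite -/(g s) -mulrA sgK; field; exact: lt0r_neq0.
have {}ki : (k < i)%N by rewrite ltn_neqAle ki andbT.
by have [<- h2] := h s k ki; rewrite signed_mx_col.
Qed.

(** As [M] is strictly lower triangular, column [j] involves only [l j] and later multipliers, so
    the equations are solved from the last column backwards. *)
Lemma exists_sign_multipliers n e (M : 'M[R]_n) (y : 'rV[R]_n) (T : {set 'I_n}) (s : signs n) :
  0 < e -> strictly_lower M ->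
  exists s' (l : 'rV[R]_n), [/\ l *m signed_mx e M s' = y,
    forall k, k \notin T -> s' k = s k & forall k, k \in T -> 0 <= l 0 k].
Proof.
move=> e0 lM.
suff H i : (i <= n)%N -> exists s' (l : 'rV[R]_n), forall k : 'I_n,
    [/\ (n - i <= k)%N -> (l *m signed_mx e M s') 0 k = y 0 k,
        k \notin T -> s' k = s k & k \in T -> 0 <= l 0 k].
  have [s' [l h]] := H n (leqnn n); exists s', l; split.
  - by apply/rowP => k; have [->] := h k; rewrite ?subnn.
  - by move=> k; have [] := h k.
  - by move=> k; have [] := h k.
elim: i => [_|i IH i_n].
  exists s, 0 => k; split=> //; last by rewrite mxE.
  by rewrite subn0 leqNgt ltn_ord.
have [s' [l h]] := IH (ltnW i_n).
have jn : (n - i.+1 < n)%N by lia.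
pose j := Ordinal jn; pose r := y 0 j - \sum_k l 0 k * M k j.
(* On [T] the sign of the diagonal entry is matched to that of the remainder [r], so that their
   quotient is nonnegative. *)
pose sj := if j \in T then 0 <= r else s j.
pose s2 : signs n := [ffun k => if k == j then sj else s' k].
pose l2 : 'rV[R]_n := \row_k (if k == j then sg sj * r / e else l 0 k).
exists s2, l2 => k; split.
- move=> jk; rewrite row_signed_mx ffunE !mxE.
  have -> : \sum_i0 l2 0 i0 * M i0 k = \sum_i0 l 0 i0 * M i0 k.
    apply: eq_bigr => i0 _; rewrite mxE; case: eqP => // ->.
    by rewrite lM ?mulr0.
  have [->|nk] := eqVneq k j.
    rewrite /r -mulrA -[sg sj * _ / _]mulrA sgK; field; exact: lt0r_neq0.
  have ik : (n - i <= k)%N by move: nk; rewrite -val_eqE /=; lia.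
  by have [/(_ ik) <- _ _] := h k; rewrite row_signed_mx.
- move=> kT; rewrite ffunE; case: eqP => [e1|_]; last by have [_ ->] := h k.
  by rewrite /sj -e1 (negPf kT).
- move=> kT; rewrite mxE; case: eqP => [e1|_]; last by have [_ _ ->] := h k.
  apply: divr_ge0; last exact: ltW.
  rewrite /sj -e1 kT /sg; case: ifPn => r0; first by rewrite mul1r.
  by rewrite mulN1r oppr_ge0 ltW // ltNge.
Qed.

(** This is complementary slackness: where [s] differs from [s0], the left-hand side of row [k]
    falls below [b k 0] by [2 e |x s k 0|], which is strictly positive, and this loss is weighted by
    [l 0 k]. *)
Lemma sign_certificate n e (M : 'M[R]_n) (b : 'cV[R]_n) x (l : 'rV[R]_n)
    (T : {set 'I_n}) (s0 s : signs n) :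
  0 < e -> (forall s, signed_mx e M s *m x s = b /\ forall k, 0 < sg (s k) * x s k 0) ->
  (forall k, k \notin T -> s k = s0 k) -> (forall k, k \in T -> 0 <= l 0 k) ->
  (l *m signed_mx e M s0 *m x s) 0 0 <= (l *m b) 0 0
    ?= iff [forall k, (k \in T) ==> (l 0 k == 0) || (s k == s0 k)].
Proof.
move=> e0 xb sT lT; rewrite -mulmxA !mxE; apply: leif_sum => k _.
have [bs /(_ k) xk] := xb s.
have -> : (signed_mx e M s0 *m x s) k 0 = b k 0 - e * (sg (s k) - sg (s0 k)) * x s k 0.
  by rewrite -bs !signed_mx_col; ring.
have [kT|kT] := boolP (k \in T) => /=; last first.
  by rewrite sT // subrr mulr0 mul0r subr0; apply/leif_refl.
have [->|l0] := eqVneq (l 0 k) 0; first by rewrite !mul0r; apply/leif_refl.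
have lp : 0 < l 0 k by rewrite lt_neqAle eq_sym l0 lT.
have [->|sk] /= := eqVneq (s k) (s0 k).
  by rewrite subrr mulr0 mul0r subr0; apply/leif_refl.
have lt : l 0 k * (b k 0 - e * (sg (s k) - sg (s0 k)) * x s k 0) < l 0 k * b k 0.
  rewrite ltr_pM2l // ltrBlDr ltrDl.
  have -> : e * (sg (s k) - sg (s0 k)) * x s k 0 = 2 * (e * (sg (s k) * x s k 0)).
    by move: sk; rewrite /sg; case: (s k); case: (s0 k) => // _; ring.
  by rewrite mulr_gt0 // mulr_gt0.
by split; [exact: ltW | rewrite lt_eqF].
Qed.

End SignedSystems.

(** * Perturbed quadratic sequences *)

Section Recurrence.

(** The equation says that the third difference of [l] at [j + 1] is [- sigma j * e * l j]. For
    [e = 0] the values from index 1 on are those of a polynomial of degree at most 2. *)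
Definition cubic_rec (A : comNzRingType) (e : A) (sigma l : nat -> A) (j : nat) : Prop :=
  l j.+4 = 3 * l j.+3 - 3 * l j.+2 + l j.+1 - sigma j * e * l j.

(** The state holds four consecutive values. The ring is arbitrary so that [e] can also be the
    indeterminate, which shows that solutions depend polynomially on [e]. *)
Fixpoint rec_state (A : comNzRingType) (e : A) (sigma : nat -> A) (a0 a1 a2 a3 : A) k :=
  if k is k'.+1 then
    let: (b0, b1, b2, b3) := rec_state e sigma a0 a1 a2 a3 k' in
    (b1, b2, b3, 3 * b3 - 3 * b2 + b1 - sigma k' * e * b0)
  else (a0, a1, a2, a3).

Definition rec_sol (A : comNzRingType) (e : A) sigma a0 a1 a2 a3 k : A :=
  (rec_state e sigma a0 a1 a2 a3 k).1.1.1.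

Lemma rec_solP (A : comNzRingType) (e : A) sigma a0 a1 a2 a3 j :
  cubic_rec e sigma (rec_sol e sigma a0 a1 a2 a3) j.
Proof.
by rewrite /cubic_rec /rec_sol /=; case: (rec_state _ _ _ _ _ _ j) => [[[b0 b1] b2] b3].
Qed.

Lemma nat_ind4 (P : nat -> Prop) : P 0%N -> P 1%N -> P 2%N -> P 3%N ->
  (forall k, P k -> P k.+1 -> P k.+2 -> P k.+3 -> P k.+4) -> forall k, P k.
Proof.
move=> P0 P1 P2 P3 PS k.
suff [] : P k /\ P k.+1 /\ P k.+2 /\ P k.+3 by [].
by elim: k => [//|k [? [? [? ?]]]]; do !split=> //; apply: PS.
Qed.

Lemma rec_sol_unique (A : comNzRingType) (e : A) sigma (l l' : nat -> A) n :
  (forall j, (j.+4 < n)%N -> cubic_rec e sigma l j) ->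
  (forall j, (j.+4 < n)%N -> cubic_rec e sigma l' j) ->
  (forall j, (j < 4)%N -> l j = l' j) -> forall j, (j < n)%N -> l j = l' j.
Proof.
move=> h h' h4; apply: nat_ind4 => [||||k] /=; try by move=> _; apply: h4.
by move=> e0 e1 e2 e3 kn; rewrite h // h' // e0 ?e1 ?e2 ?e3 //; lia.
Qed.

Lemma rec_sol0 (A : comNzRingType) (sigma : nat -> A) a0 (p : nat -> A) k :
  (forall k, p k.+4 = 3 * p k.+3 - 3 * p k.+2 + p k.+1) ->
  rec_sol 0 sigma a0 (p 1%N) (p 2%N) (p 3%N) k.+1 = p k.+1.
Proof.
move=> h; suff [] : rec_sol 0 sigma a0 (p 1%N) (p 2%N) (p 3%N) k.+1 = p k.+1 /\
  rec_sol 0 sigma a0 (p 1%N) (p 2%N) (p 3%N) k.+2 = p k.+2 /\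
  rec_sol 0 sigma a0 (p 1%N) (p 2%N) (p 3%N) k.+3 = p k.+3 by [].
elim: k => [//|k [h1 [h2 h3]]]; do !split=> //.
by rewrite rec_solP h1 h2 h3 h mulr0 mul0r subr0.
Qed.

Lemma rec_sol_horner (A : comNzRingType) (sigma : nat -> A) a0 a1 a2 a3 x k :
  (rec_sol 'X (fun k => (sigma k)%:P) a0%:P a1%:P a2%:P a3%:P k).[x] =
  rec_sol x sigma a0 a1 a2 a3 k.
Proof.
elim/nat_ind4: k => [||||k]; rewrite ?hornerC // => h0 h1 h2 h3.
rewrite !rec_solP -h0 -h1 -h2 -h3 !hornerE /=.
ring.
Qed.

(* The minor at positions [a < b < c] of the three solutions vanishing at 0. *)
Definition rec_minor (A : comNzRingType) (e : A) sigma a b c : A :=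
  let m1 := rec_sol e sigma 0 1 0 0 in
  let m2 := rec_sol e sigma 0 0 1 0 in
  let m3 := rec_sol e sigma 0 0 0 1 in
  m1 a * (m2 b * m3 c - m3 b * m2 c) - m2 a * (m1 b * m3 c - m3 b * m1 c)
  + m3 a * (m1 b * m2 c - m2 b * m1 c).

(** Since [l] vanishes at 0, it is a combination of the three basic solutions; its zeros at [a],
    [b], [c] give a 3 by 3 linear system, and Cramer's rule shows that the coefficients vanish. *)
Lemma rec_sol_zero (A : idomainType) (e : A) sigma (l : nat -> A) n a b c :
  (forall j, (j.+4 < n)%N -> cubic_rec e sigma l j) ->
  (a < n)%N -> (b < n)%N -> (c < n)%N -> rec_minor e sigma a b c != 0 ->
  l 0%N = 0 -> l a = 0 -> l b = 0 -> l c = 0 -> (3 < n)%N ->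
  forall j, (j < n)%N -> l j = 0.
Proof.
move=> hl an bn cn D0 l0 la lb lc n3.
pose m1 := rec_sol e sigma 0 1 0 0; pose m2 := rec_sol e sigma 0 0 1 0.
pose m3 := rec_sol e sigma 0 0 0 1.
have lE j : (j < n)%N -> l j = l 1%N * m1 j + l 2%N * m2 j + l 3%N * m3 j.
  pose l' j := l 1%N * m1 j + l 2%N * m2 j + l 3%N * m3 j.
  apply: (rec_sol_unique (l' := l') hl) => [i _|[|[|[|[|//]]]] _]; rewrite /l'.
  - by rewrite /cubic_rec /m1 /m2 /m3 !rec_solP; ring.
  - by rewrite l0 /m1 /m2 /m3 /rec_sol /=; ring.
  - by rewrite /m1 /m2 /m3 /rec_sol /=; ring.
  - by rewrite /m1 /m2 /m3 /rec_sol /=; ring.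
  - by rewrite /m1 /m2 /m3 /rec_sol /=; ring.
have Ea := lE a an; have Eb := lE b bn; have Ec := lE c cn.
rewrite la in Ea; rewrite lb in Eb; rewrite lc in Ec.
have z x : x * rec_minor e sigma a b c = 0 -> x = 0.
  by move/eqP; rewrite mulf_eq0 (negPf D0) orbF => /eqP.
have cr u v w : 0 * u - 0 * v + 0 * w = 0 :> A by ring.
have l1 : l 1%N = 0.
  apply: z; rewrite -[RHS](cr (m2 b * m3 c - m3 b * m2 c)
    (m2 a * m3 c - m3 a * m2 c) (m2 a * m3 b - m3 a * m2 b)).
  by rewrite {1}Ea {1}Eb {1}Ec /rec_minor -/m1 -/m2 -/m3; ring.
have l2 : l 2%N = 0.
  apply: z; rewrite -[RHS](cr (m3 b * m1 c - m1 b * m3 c)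
    (m3 a * m1 c - m1 a * m3 c) (m3 a * m1 b - m1 a * m3 b)).
  by rewrite {1}Ea {1}Eb {1}Ec /rec_minor -/m1 -/m2 -/m3; ring.
have l3 : l 3%N = 0.
  apply: z; rewrite -[RHS](cr (m1 b * m2 c - m2 b * m1 c)
    (m1 a * m2 c - m2 a * m1 c) (m1 a * m2 b - m2 a * m1 b)).
  by rewrite {1}Ea {1}Eb {1}Ec /rec_minor -/m1 -/m2 -/m3; ring.
by move=> j jn; rewrite lE // l1 l2 l3 !mul0r !addr0.
Qed.

Lemma rec_minor0 (F : numFieldType) (sigma : nat -> F) a b c :
  (0 < a)%N -> (a < b)%N -> (b < c)%N -> rec_minor 0 sigma a b c != 0.
Proof.
move=> a0 ab bc.
(* These are the Lagrange polynomials for the nodes 1, 2, 3; the minor below is the Vandermonde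
   determinant of [a], [b], [c] divided by that of the nodes, which is 2. *)
pose p1 k : F := (k%:R - 2) * (k%:R - 3) / 2.
pose p2 k : F := - (k%:R - 1) * (k%:R - 3).
pose p3 k : F := (k%:R - 1) * (k%:R - 2) / 2.
have two : 2 != 0 :> F by rewrite pnatr_eq0.
have m1 k : (0 < k)%N -> rec_sol 0 sigma 0 1 0 0 k = p1 k.
  case: k => // k _; rewrite -(rec_sol0 sigma 0 (p := p1)) => [|i]; last first.
    by rewrite /p1 -[i.+4]addn4 -[i.+3]addn3 -[i.+2]addn2 -[i.+1]addn1 !natrD; field.
  by congr (rec_sol _ _ _ _ _ _ _); rewrite /p1; field.
have m2 k : (0 < k)%N -> rec_sol 0 sigma 0 0 1 0 k = p2 k.
  case: k => // k _; rewrite -(rec_sol0 sigma 0 (p := p2)) => [|i]; last first.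
    by rewrite /p2 -[i.+4]addn4 -[i.+3]addn3 -[i.+2]addn2 -[i.+1]addn1 !natrD; ring.
  by congr (rec_sol _ _ _ _ _ _ _); rewrite /p2; ring.
have m3 k : (0 < k)%N -> rec_sol 0 sigma 0 0 0 1 k = p3 k.
  case: k => // k _; rewrite -(rec_sol0 sigma 0 (p := p3)) => [|i]; last first.
    by rewrite /p3 -[i.+4]addn4 -[i.+3]addn3 -[i.+2]addn2 -[i.+1]addn1 !natrD; field.
  by congr (rec_sol _ _ _ _ _ _ _); rewrite /p3; field.
rewrite /rec_minor !m1 ?m2 ?m3; try lia.
have -> : p1 a * (p2 b * p3 c - p3 b * p2 c) - p2 a * (p1 b * p3 c - p3 b * p1 c)
  + p3 a * (p1 b * p2 c - p2 b * p1 c) =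
  (b%:R - a%:R) * (c%:R - a%:R) * (c%:R - b%:R) / 2 by rewrite /p1 /p2 /p3; field.
have ne i j : (i < j)%N -> j%:R - i%:R != 0 :> F.
  by move=> ij; rewrite subr_eq0 eqr_nat gtn_eqF.
by rewrite !mulf_neq0 ?invr_eq0 ?ne //; apply: ltn_trans bc.
Qed.

(* For [e = 0] this is [(k - i)^2] if [0 < i]; if [i = 0] it is 0 at 0 and 1
   elsewhere. *)
Definition rec_edge (A : comNzRingType) (e : A) sigma i k : A :=
  let q t : A := (t%:R - i%:R) ^+ 2 in
  let q1 := rec_sol e sigma (q 0%N) (q 1%N) (q 2%N) (q 3%N) in
  let q2 := rec_sol e sigma 1 1 1 1 in
  if i is 0 then rec_sol e sigma 0 1 1 1 k else q1 k * q2 i - q1 i * q2 k.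

Lemma rec_edgeP (A : comNzRingType) (e : A) sigma i j :
  cubic_rec e sigma (rec_edge e sigma i) j.
Proof.
rewrite /rec_edge /cubic_rec; case: i => [|i]; first exact: rec_solP.
by rewrite !rec_solP; ring.
Qed.

(** The two products in [rec_edge] cancel at [i] for every [e], so the zero stays exact under
    perturbation while the other values only need to stay positive. *)
Lemma rec_edge_zero (A : comNzRingType) (e : A) sigma i : rec_edge e sigma i i = 0.
Proof. by rewrite /rec_edge; case: i => [|i]; rewrite ?subrr. Qed.

Lemma rec_edge0 (F : realFieldType) (sigma : nat -> F) i k :
  k != i -> 0 < rec_edge 0 sigma i k.
Proof.
have one a0 j : rec_sol 0 sigma a0 1 1 1 j.+1 = 1.
  by rewrite (rec_sol0 sigma a0 (p := fun=> 1)) // => _; ring.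
rewrite /rec_edge; case: i => [|i] ki; first by case: k ki => // k _; rewrite one ltr01.
pose p t : F := (t%:R - i.+1%:R) ^+ 2.
have pE t : rec_sol 0 sigma (p 0%N) (p 1%N) (p 2%N) (p 3%N) t = p t.
  case: t => [//|t]; apply: rec_sol0 => j.
  by rewrite /p -[j.+4]addn4 -[j.+3]addn3 -[j.+2]addn2 -[j.+1]addn1 !natrD; ring.
have o1 t : rec_sol 0 sigma 1 1 1 1 t = 1 by case: t.
rewrite -!/(p _) !pE !o1 {2}/p subrr expr0n /= mulr1 mul0r subr0 /p.
by rewrite lt_neqAle sqr_ge0 andbT eq_sym expf_eq0 /= subr_eq0 eqr_nat.
Qed.

End Recurrence.

(** * Conditions valid for all sufficiently small positive parameters *)

Section Smallness.
Context {R : realType}.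

Definition small_pos (P : R -> Prop) : Prop :=
  exists2 d, 0 < d & forall x, 0 < x -> x < d -> P x.

Lemma small_pos_all (I : finType) (P : I -> R -> Prop) :
  (forall i, small_pos (P i)) -> small_pos (fun x => forall i, P i x).
Proof.
move=> h; have H i : exists d, 0 < d /\ forall x, 0 < x -> x < d -> P i x.
  by have [d d0 hd] := h i; exists d.
have [d hd] := boolp.choice H.
have [m m0 hm] := pos_lower_bound [seq d i | i : I].
exists m => // x x0 xm i; have [d0 di] := hd i; apply: di => //.
by apply: lt_trans xm _; apply: hm => //; rewrite map_f // mem_enum.
Qed.

Lemma small_pos_and (P Q : R -> Prop) :
  small_pos P -> small_pos Q -> small_pos (fun x => P x /\ Q x).
Proof.
move=> [d d0 hd] [d' d'0 hd']; exists (Num.min d d'); first by rewrite lt_min d0.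
by move=> x x0; rewrite lt_min => /andP[xd xd']; split; [apply: hd | apply: hd'].
Qed.

Lemma small_pos_poly (p : {poly R}) : 0 < p.[0] -> small_pos (fun x => 0 < p.[x]).
Proof.
move=> p0; have [d d0 h] := poly_cont 0 p p0; exists d => // x x0 xd.
have : `|p.[x] - p.[0]| < p.[0] by apply: h; rewrite subr0 gtr0_norm.
by rewrite ltr_norml => /andP[+ _]; lra.
Qed.

Lemma small_pos_minor (sigma : nat -> R) a b c :
  (0 < a)%N -> (a < b)%N -> (b < c)%N ->
  small_pos (fun x => rec_minor x sigma a b c != 0).
Proof.
move=> a0 ab bc; pose p := rec_minor 'X (fun k => (sigma k)%:P) a b c.
have pE x : p.[x] = rec_minor x sigma a b c.
  rewrite /p /rec_minor -[0]/(0%:P) -[1]/(1%:P).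
  by rewrite !hornerE !rec_sol_horner.
(* Squaring turns nonvanishing into positivity, which persists near 0 by continuity. *)
have [|d d0 h] := @small_pos_poly (p ^+ 2).
  by rewrite horner_exp lt_neqAle sqr_ge0 andbT eq_sym expf_eq0 /= pE rec_minor0.
exists d => // x x0 xd; have := h x x0 xd; rewrite horner_exp pE.
by apply: contraTneq => ->; rewrite expr0n ltxx.
Qed.

Lemma small_pos_edge (sigma : nat -> R) i k : k != i ->
  small_pos (fun x => 0 < rec_edge x sigma i k).
Proof.
move=> ki; pose p := rec_edge 'X (fun k => (sigma k)%:P) i k.
have pE x : p.[x] = rec_edge x sigma i k.
  rewrite /p /rec_edge -!polyC_natr -!polyCB -!polyC_exp -[0]/(0%:P) -[1]/(1%:P).
  by case: i {ki p} => [|i]; rewrite ?hornerE !rec_sol_horner.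
have [|d d0 h] := @small_pos_poly p; first by rewrite pE rec_edge0.
by exists d => // x x0 xd; rewrite -pE; apply: h.
Qed.

End Smallness.

(** * The third difference matrix and its multipliers *)

Section Band.
Context {R : realType}.
Variable N : nat.

(** The last four columns are zero; they belong to the coordinates that the projection keeps. *)
Definition band_entry (k j : nat) : R :=
  if (j < N)%N && (j < k)%N then nth 0 [:: -1; 3; -3; 1] (k - j.+1) else 0.

Definition band_mx : 'M[R]_(N + 4) := \matrix_(k, j) band_entry k j.

Lemma band_strictly_lower : strictly_lower band_mx.
Proof.
move=> k j kj; rewrite mxE /band_entry.
have -> : (j < k)%N = false by lia.
by rewrite andbF.
Qed.

Definition seq_of_row n (l : 'rV[R]_n) (k : nat) : R :=
  if insub k is Some i then l 0 i else 0.

Lemma seq_of_rowE n (l : 'rV[R]_n) (i : 'I_n) : seq_of_row l i = l 0 i.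
Proof. by rewrite /seq_of_row valK. Qed.

Definition sign_seq n (s : signs n) (k : nat) : R :=
  if insub k is Some i then sg (s i) else 1.

Lemma sign_seqE n (s : signs n) (i : 'I_n) : sign_seq s i = sg (s i).
Proof. by rewrite /sign_seq valK. Qed.

Lemma sum_band (f : nat -> R) j : (j < N)%N ->
  \sum_(k < N + 4) f k * band_entry k j = - f j.+1 + 3 * f j.+2 - 3 * f j.+3 + f j.+4.
Proof.
move=> jN; rewrite -(big_mkord predT (fun k => f k * band_entry k j)) /=.
rewrite (big_cat_nat (n := j.+1)) //=; last by lia.
rewrite (big_cat_nat (n := j.+1 + 4) (m := j.+1)) //=; try lia.
rewrite [X in X + _]big_nat_cond [X in X + _]big1 ?add0r; last first.
  move=> k /andP[/andP[_ kj] _]; rewrite /band_entry.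
  have -> : (j < k)%N = false by lia.
  by rewrite andbF mulr0.
rewrite [X in _ + X]big_nat_cond [X in _ + X]big1 ?addr0; last first.
  move=> k /andP[/andP[kj _] _]; rewrite /band_entry; case: ifP => _; last exact: mulr0.
  by rewrite nth_default ?mulr0 //=; lia.
rewrite addn4; do 4![rewrite big_nat_recl; last by lia]; rewrite big_geq // addr0.
have E i : (i < 4)%N -> band_entry (j.+1 + i) j = nth 0 [:: -1; 3; -3; 1] i.
  by move=> i4; rewrite /band_entry jN /= addSn leq_addr /= -addSn addKn.
have := E 0%N isT; have := E 1%N isT; have := E 2%N isT; have := E 3%N isT.
rewrite addn0 addn1 addn2 addn3 => -> -> -> -> /=; ring.
Qed.

(** A row of the form [row_mx 0 c] is a functional that factors through the last four coordinates;
    its first [N] entries are the equations of the recurrence. *)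
Lemma band_rec e (s : signs (N + 4)) (l : 'rV[R]_(N + 4)) :
  (exists c, l *m signed_mx e band_mx s = row_mx 0 c) <->
  (forall j, (j < N)%N ->
     - (seq_of_row l j.+4 - 3 * seq_of_row l j.+3 + 3 * seq_of_row l j.+2
        - seq_of_row l j.+1) = sign_seq s j * e * seq_of_row l j).
Proof.
have E (j : 'I_N) : (l *m signed_mx e band_mx s) 0 (lshift 4 j) =
    sign_seq s j * e * seq_of_row l j + (seq_of_row l j.+4 - 3 * seq_of_row l j.+3
    + 3 * seq_of_row l j.+2 - seq_of_row l j.+1).
  rewrite row_signed_mx -seq_of_rowE -sign_seqE /=.
  under eq_bigr => k _ do rewrite mxE -seq_of_rowE.
  by rewrite sum_band //=; ring.
split=> [[c H] j jN|H].
  have := E (Ordinal jN); rewrite H row_mxEl mxE /= => /eqP.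
  by rewrite eq_sym addr_eq0 => /eqP ->.
exists (rsubmx (l *m signed_mx e band_mx s)); rewrite -[LHS]hsubmxK; congr row_mx.
by apply/rowP => j; rewrite [RHS]mxE [LHS]mxE E -H ?addNr.
Qed.

Lemma min_elt n (Z : {set 'I_n}) : (0 < #|Z|)%N ->
  exists2 r, r \in Z & forall k, k \in Z -> (r <= k)%N.
Proof.
case/card_gt0P => i0 i0Z; exists [arg min_(i < i0 in Z) (i : nat)]; by case: arg_minnP.
Qed.

Lemma next_elt n (Z : {set 'I_n}) m : (m.+1 < #|Z|)%N ->
  exists r, [/\ r \in Z, (m < #|Z :\ r|)%N & forall k, k \in Z :\ r -> (r < k)%N].
Proof.
move=> mZ; have [|r rZ rm] := @min_elt n Z; first exact: leq_trans mZ.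
exists r; split=> // [|k]; first by move: mZ; rewrite (cardsD1 r) rZ.
rewrite !inE => /andP[kr kZ]; rewrite ltn_neqAle rm // andbT.
by apply: contra kr => /eqP e; apply/eqP/val_inj.
Qed.

Lemma four_increasing n (Z : {set 'I_n}) : (4 <= #|Z|)%N -> exists r a b c : 'I_n,
  [/\ r \in Z, a \in Z, b \in Z & c \in Z] /\ [/\ (r < a)%N, (a < b)%N & (b < c)%N].
Proof.
move=> Z4; have [r [rZ r3 rm]] := next_elt Z4; have [a [aZ a2 am]] := next_elt r3.
have [b [bZ b1 bm]] := next_elt a2; have [c cZ _] := min_elt b1.
exists r, a, b, c; have cb := bm c cZ.
move: (cZ) (bZ) (aZ); rewrite !inE => /and4P[_ _ _ ->] /and3P[_ _ ->] /andP[_ ->].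
split=> //; split=> //; first exact: rm.
exact: am.
Qed.

(* If four multipliers vanish, the sequence after the first zero [r] solves
   the recurrence with value 0 at its start, so three more zeros make it
   vanish identically; the multipliers before [r] are then determined downwards. *)
Lemma band_four_zeros e (s : signs (N + 4)) (l : 'rV[R]_(N + 4)) :
  e != 0 ->
  (forall (r a b c : 'I_(N + 4)), (0 < a)%N -> (a < b)%N -> (b < c)%N ->
     rec_minor e (fun k => sign_seq s (r + k)) a b c != 0) ->
  (exists c, l *m signed_mx e band_mx s = row_mx 0 c) ->
  (4 <= #|[set k | (l 0 k == 0)%R]%SET|)%N -> l = 0.
Proof.
move=> e0 minor /band_rec H /four_increasing[r [a [b [c [[rZ aZ bZ cZ] [ra ab bc]]]]]].
pose L := seq_of_row l.
have sg0 j : sign_seq s j != 0.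
  rewrite /sign_seq; case: insub => [i|]; rewrite ?oner_eq0 // /sg.
  by case: (s i); rewrite ?oppr_eq0 oner_eq0.
have LZ (k : 'I_(N + 4)) : k \in [set k | l 0 k == 0]%SET -> L k = 0.
  by rewrite inE /L seq_of_rowE => /eqP.
have cn := ltn_ord c.
have rn (k : 'I_(N + 4)) : (k - r < N + 4)%N.
  by apply: leq_ltn_trans (leq_subr _ _) (ltn_ord k).
have tail j : (j < N + 4 - r)%N -> L (r + j)%N = 0.
  apply: (@rec_sol_zero _ e (fun k => sign_seq s (r + k)) (fun j => L (r + j)%N)
    (N + 4 - r) (a - r) (b - r) (c - r)) => [i ir|||||||||]; try lia.
  - have iN : (r + i < N)%N by lia.
    by have := H _ iN; rewrite -/L -!addnS /cubic_rec => <-; ring.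
  - by apply: (minor r (Ordinal (rn a)) (Ordinal (rn b)) (Ordinal (rn c))) => /=; lia.
  - by rewrite addn0; apply: LZ.
  - by rewrite subnKC ?LZ //; lia.
  - by rewrite subnKC ?LZ //; lia.
  - by rewrite subnKC ?LZ //; lia.
have down i j : (r - i <= j)%N -> (j < N + 4)%N -> L j = 0.
  elim: i j => [|i IH] j rj jn.
    by rewrite -[j](@subnKC r) ?tail //; lia.
  have [h|h] := leqP (r - i) j; first exact: IH.
  have jN : (j < N)%N by lia.
  have := H j jN; rewrite -/L (IH j.+1) ?(IH j.+2) ?(IH j.+3) ?(IH j.+4); try lia.
  rewrite !mulr0 !subr0 addr0 oppr0 => /esym/eqP.
  by rewrite !mulf_eq0 (negPf (sg0 j)) (negPf e0) /= => /eqP.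
apply/rowP => k; rewrite mxE -seq_of_rowE; apply: (down r) => //.
by rewrite subnn.
Qed.

Lemma band_edge e (s : signs (N + 4)) (i : 'I_(N + 4)) :
  (forall k : 'I_(N + 4), k != i -> 0 < rec_edge e (sign_seq s) i k) ->
  exists l : 'rV[R]_(N + 4), [/\ exists c, l *m signed_mx e band_mx s = row_mx 0 c,
    l 0 i = 0 & forall k, k != i -> 0 < l 0 k].
Proof.
move=> pos; pose l : 'rV[R]_(N + 4) := \row_k rec_edge e (sign_seq s) i k.
exists l; split=> [||k ki]; rewrite ?mxE ?rec_edge_zero ?pos //.
apply/band_rec => j jN.
have E k : (k < N + 4)%N -> seq_of_row l k = rec_edge e (sign_seq s) i k.
  by move=> kn; rewrite -[k]/(val (Ordinal kn)) seq_of_rowE mxE.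
rewrite !E; try lia; rewrite rec_edgeP; ring.
Qed.

Theorem exists_good_band : exists e : R, [/\ 0 < e,
  forall s (l : 'rV[R]_(N + 4)), (exists c, l *m signed_mx e band_mx s = row_mx 0 c) ->
    (4 <= #|[set k | (l 0 k == 0)%R]%SET|)%N -> l = 0
  & forall s (i : 'I_(N + 4)), exists l : 'rV[R]_(N + 4),
    [/\ exists c, l *m signed_mx e band_mx s = row_mx 0 c,
    l 0 i = 0 & forall k, k != i -> 0 < l 0 k]].
Proof.
pose I := ('I_(N + 4) * 'I_(N + 4) * 'I_(N + 4) * 'I_(N + 4))%type.
(* The signs are shifted by [r] because the recurrence will be restarted at the first zero [r] of a
   sequence. *)
pose P (s : signs (N + 4)) (t : I) e := let: (r, a, b, c) := t in
  (0 < a)%N -> (a < b)%N -> (b < c)%N ->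
  rec_minor e (fun k => sign_seq s (r + k)) a b c != 0.
pose Q (s : signs (N + 4)) (t : 'I_(N + 4) * 'I_(N + 4)) e :=
  t.2 != t.1 -> 0 < rec_edge e (sign_seq s) t.1 t.2.
have small_imp (B : Prop) (S : R -> Prop) : (B -> small_pos S) -> small_pos (fun x => B -> S x).
  move=> h; have [B1|nB] := pselect B; last by exists 1 => // x _ _ /nB.
  by have [d d0 hd] := h B1; exists d => // x x0 xd _; apply: hd.
have [d d0 h] : small_pos (fun e => (forall s t, P s t e) /\ (forall s t, Q s t e)).
  apply: small_pos_and; apply: small_pos_all => s; apply: small_pos_all.
    move=> [[[r a] b] c]; rewrite /P.
    apply: (small_imp) => a0; apply: (small_imp) => ab; apply: (small_imp) => bc.
    exact: small_pos_minor.
  by move=> [i k]; apply: (small_imp) => ki; apply: small_pos_edge.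
have e0 : 0 < d / 2 by rewrite divr_gt0.
have ed : d / 2 < d by lra.
have [hP hQ] := h _ e0 ed; exists (d / 2); split=> // [s l|s i].
  apply: band_four_zeros; first exact: lt0r_neq0.
  by move=> r a b c; apply: (hP s (r, a, b, c)).
by apply: band_edge => k ki; apply: (hQ s (i, k)).
Qed.

End Band.

(** * Projected cubes *)

Section ExtendSigns.
Variables (n : nat) (T : {set 'I_n}) (s0 : signs n).

Definition extend_signs (s : signs #|T|) : signs n :=
  [ffun k => if [pick j : 'I_#|T| | enum_val j == k] is Some j then s j else s0 k].

Lemma extend_signs_in s j : extend_signs s (enum_val j) = s j.
Proof.
rewrite ffunE; case: pickP => [i /eqP/enum_val_inj -> //|/(_ j)].
by rewrite eqxx.
Qed.

Lemma extend_signs_out s k : k \notin T -> extend_signs s k = s0 k.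
Proof.
move=> kT; rewrite ffunE; case: pickP => [i /eqP ik|//].
by move: kT; rewrite -ik enum_valP.
Qed.

Lemma extend_signs_inj : injective extend_signs.
Proof.
move=> s s' e; apply/ffunP => j.
by rewrite -extend_signs_in e extend_signs_in.
Qed.

Lemma extend_signs_image : extend_signs @: finset.setT = subcube T s0.
Proof.
apply/setP => s; apply/imsetP/in_subcube => [[s' _ ->] k kT|h].
  exact: extend_signs_out.
exists [ffun j => s (enum_val j)]; first by rewrite finset.in_setT.
apply/ffunP => k; have [kT|kT] := boolP (k \in T).
  by rewrite -[k](enum_rankK_in kT kT) extend_signs_in ffunE.
by rewrite extend_signs_out // h.
Qed.

End ExtendSigns.

Arguments extend_signs {n} T s0 s.

Section Construction.
Context {R : realType}.
Variables (N : nat) (e : R) (M : 'M[R]_(N + 4)).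
Hypotheses (e0 : 0 < e) (lM : strictly_lower M).
Let n := (N + 4)%N.
Variables (b : 'cV[R]_n) (x : signs n -> 'cV[R]_n).
Hypothesis xb : forall s, signed_mx e M s *m x s = b /\ forall k, 0 < sg (s k) * x s k 0.
Hypothesis four_zeros : forall s (l : 'rV[R]_n),
  (exists c, l *m signed_mx e M s = row_mx 0 c) ->
  (4 <= #|[set k | (l 0 k == 0)%R]%SET|)%N -> l = 0.
(* Multipliers certifying that the edge in direction [i] at the vertex [s] is
   preserved by the projection. *)
Hypothesis edge : forall s (i : 'I_n), exists l : 'rV[R]_n,
  [/\ exists c, l *m signed_mx e M s = row_mx 0 c,
      l 0 i = 0 & forall k, k != i -> 0 < l 0 k].

Definition proj_vertex (s : signs n) : 'rV[R]_4 := (dsubmx (x s))^T.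

Lemma dot_proj (c : 'rV[R]_4) (l : 'rV[R]_n) s0 s :
  l *m signed_mx e M s0 = row_mx 0 c ->
  dot c^T (proj_vertex s) = (l *m signed_mx e M s0 *m x s) 0 0.
Proof.
move=> ->; rewrite -[x s]vsubmxK mul_row_col mul0mx add0r /dot.
by rewrite -trmx_mul mxE.
Qed.

Lemma proj_certificate (c : 'rV[R]_4) (l : 'rV[R]_n) (T : {set 'I_n}) (s0 s : signs n) :
  l *m signed_mx e M s0 = row_mx 0 c ->
  (forall k, k \notin T -> s k = s0 k) -> (forall k, k \in T -> 0 <= l 0 k) ->
  dot c^T (proj_vertex s) <= (l *m b) 0 0
    ?= iff [forall k, (k \in T) ==> (l 0 k == 0) || (s k == s0 k)].
Proof. by move=> lc sT lT; rewrite (dot_proj s lc); apply: (sign_certificate e0 xb). Qed.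

(** With all signs free, [c] has nonnegative multipliers, and its maximum is taken where the signs
    agree with [s0] outside the zeros of [l]. Four zeros would give [l = 0], hence [c = 0]. *)
Lemma proj_functional (c : 'cV[R]_4) : c != 0 ->
  exists b (T : {set 'I_n}) s0, (#|T| <= 3)%N /\
    forall s, dot c (proj_vertex s) <= b ?= iff (s \in subcube T s0).
Proof.
move=> c0; pose s1 : signs n := [ffun => true].
have [s0 [l [lc _ l0]]] :=
  exists_sign_multipliers (row_mx 0 c^T) finset.setT s1 e0 lM.
exists ((l *m b) 0 0), [set k | l 0 k == 0]%SET, s0; split=> [|s].
  rewrite leqNgt; apply: contra c0 => l4.
  have l00 : l = 0 by apply: (four_zeros (s := s0)) => //; exists c^T.
  move: lc; rewrite l00 mul0mx -row_mx0 => /eq_row_mx [_ /esym/(congr1 trmx)].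
  by rewrite trmxK trmx0 => ->.
have sT k : k \notin [set: 'I_n]%SET -> s k = s0 k by rewrite finset.in_setT.
have := proj_certificate lc sT l0; rewrite trmxK.
suff -> : (s \in subcube [set k | l 0 k == 0]%SET s0) =
   [forall k, (k \in [set: 'I_n]%SET) ==> (l 0 k == 0) || (s k == s0 k)] by [].
by rewrite inE; apply: eq_forallb => k; rewrite !inE.
Qed.

(** Enlarge [T] to four positions. The linear map from [c] to the multipliers at these positions is
    injective by [four_zeros], hence bijective, so any values can be prescribed. *)
Lemma multipliers_on (s : signs n) (T : {set 'I_n}) (t : 'I_n -> R) : (#|T| <= 3)%N ->
  exists (l : 'rV[R]_n) (c : 'rV[R]_4),
    l *m signed_mx e M s = row_mx 0 c /\ forall k, k \in T -> l 0 k = t k.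
Proof.
move=> T3.
have [T' TT' T4] : exists2 T' : {set 'I_n}, T \subset T' & #|T'| = 4%N.
  have : (4 <= #|[set: 'I_n]%SET|)%N by rewrite cardsT card_ord leq_addl.
  have : T \subset [set: 'I_n]%SET by apply/fintype.subsetP => k; rewrite finset.in_setT.
  move: [set: 'I_n]%SET => U; move: {2}#|U| (leqnn #|U|) => k.
  elim: k U => [|k IH] U Uk TU U4; first by lia.
  have [e4|n4] := eqVneq #|U| 4%N; first by exists U.
  have /subsetPn [i iU iT] : ~~ (U \subset T).
    by apply/negP => /subset_leq_card; lia.
  apply: (IH (U :\ i)%SET); have := cardsD1 i U; rewrite iU; try lia.
  by move=> _; rewrite subsetD1 TU.
have As := signed_mx_unit s (lt0r_neq0 e0) lM.
pose J : 'M[R]_(4, n) := row_mx 0 1%:M.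
pose f (j : 'I_4) : 'I_n := enum_val (cast_ord (esym T4) j).
pose E : 'M[R]_4 := colsub f (J *m invmx (signed_mx e M s)).
have EE (c : 'rV[R]_4) j : (c *m J *m invmx (signed_mx e M s)) 0 (f j) = (c *m E) 0 j.
  by rewrite -mulmxA /E mulmx_colsub [RHS]mxE.
have AE (c : 'rV[R]_4) : c *m J *m invmx (signed_mx e M s) *m signed_mx e M s = row_mx 0 c.
  by rewrite mulmxKV // mul_mx_row mulmx0 mulmx1.
have Eu : E \in unitmx.
  rewrite -row_free_unit -kermx_eq0; apply/rowV0P => c /sub_kermxP cE.
  have l0 : c *m J *m invmx (signed_mx e M s) = 0.
    apply: (four_zeros (s := s)); first by exists c; rewrite AE.
    rewrite -[X in (X <= _)%N]T4; apply/subset_leq_card/fintype.subsetP => k kT; rewrite inE.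
    have -> : k = f (cast_ord T4 (enum_rank_in kT k)).
      by rewrite /f cast_ordK enum_rankK_in.
    by rewrite EE cE mxE.
  by have := AE c; rewrite l0 mul0mx -row_mx0 => /eq_row_mx [].
pose c := (\row_j t (f j)) *m invmx E.
exists (c *m J *m invmx (signed_mx e M s)), c; split; first exact: AE.
move=> k kT; have kT' := fintype.subsetP TT' k kT.
have -> : k = f (cast_ord T4 (enum_rank_in kT' k)).
  by rewrite /f cast_ordK enum_rankK_in.
by rewrite EE mulmxKV // mxE.
Qed.

(** Freeing only the signs in [T] shows that each functional is maximal on a subcube. Conversely,
    multipliers that are 0 on the wanted directions and 1 on the others of [T] expose any given
    subcube. *)
Lemma face_cube_like (T : {set 'I_n}) (s0 : signs n) : (#|T| <= 3)%N ->
  cube_like (proj_vertex \o extend_signs T s0).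
Proof.
move=> T3.
have cert (c : 'rV[R]_4) (l : 'rV[R]_n) s' :
    l *m signed_mx e M s' = row_mx 0 c -> (forall k, k \notin T -> s' k = s0 k) ->
    (forall k, k \in T -> 0 <= l 0 k) ->
    forall s, dot c^T (proj_vertex (extend_signs T s0 s)) <= (l *m b) 0 0 ?= iff
      (s \in subcube [set j | l 0 (enum_val j) == 0]%SET [ffun j => s' (enum_val j)]).
  move=> lc s's0 lT s.
  have sT k : k \notin T -> extend_signs T s0 s k = s' k.
    by move=> kT; rewrite extend_signs_out // s's0.
  have := proj_certificate lc sT lT; rewrite inE.
  suff -> : [forall k, (k \in T) ==> (l 0 k == 0) || (extend_signs T s0 s k == s' k)] =
    [forall j, (j \in [set j | l 0 (enum_val j) == 0]%SET)
       || (s j == [ffun j => s' (enum_val j)] j)] by [].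
  apply/forallP/forallP => h j; last first.
    apply/implyP => jT; have := h (enum_rank_in jT j).
    by rewrite inE ffunE -(extend_signs_in s0) enum_rankK_in.
  have := h (enum_val j); rewrite enum_valP extend_signs_in inE ffunE /=.
  by [].
apply: cube_like_intro => [c|T' s].
  have [s' [l [lc s's0 lT]]] := exists_sign_multipliers (row_mx 0 c^T) T s0 e0 lM.
  do 3!eexists; move=> s; have := cert _ _ _ lc s's0 lT s; rewrite trmxK; exact: id.
pose s' := extend_signs T s0 s.
pose t k : R := if [exists j, (enum_val j == k) && (j \in T')] then 0 else 1.
have [l [c [lc lt]]] := multipliers_on s' t T3.
have s's0 k : k \notin T -> s' k = s0 k by apply: extend_signs_out.
have l0 k : k \in T -> 0 <= l 0 k.
  by move=> kT; rewrite lt // /t; case: ifP => _; rewrite ?ler01.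
exists c^T, ((l *m b) 0 0) => s2; have := cert _ _ _ lc s's0 l0 s2.
suff -> : subcube [set j | l 0 (enum_val j) == 0]%SET [ffun j => s' (enum_val j)] =
  subcube T' s by [].
have -> : [ffun j => s' (enum_val j)] = s.
  by apply/ffunP => j; rewrite ffunE extend_signs_in.
congr subcube; apply/setP => j; rewrite inE lt ?enum_valP // /t.
case: ifPn => [/existsP[i /andP[/eqP/enum_val_inj -> ->]]|]; first by rewrite eqxx.
rewrite negb_exists oner_eq0 => /forallP /(_ j); rewrite eqxx /= => /negPf ->.
by [].
Qed.

Definition projected_cube : set 'rV[R]_4 := hull proj_vertex finset.setT.

Lemma face_comb_equiv (T : {set 'I_n}) (s0 : signs n) : (#|T| <= 3)%N ->
  comb_equiv (faces (hull proj_vertex (subcube T s0))) (faces (@cube R #|T|)).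
Proof.
move=> T3; rewrite -extend_signs_image -(hull_reindex _ _ (@extend_signs_inj n T s0)).
rewrite cube_hull; apply: comb_equiv_exposed => S.
by rewrite (face_cube_like s0 T3 S) (cube_like_cube S).
Qed.

Lemma face_has_dim (T : {set 'I_n}) (s0 : signs n) : (#|T| <= 3)%N ->
  has_dim (hull proj_vertex (subcube T s0)) #|T|.
Proof.
move=> T3; have [H _] := comb_equiv_face_num (hull_polytope proj_vertex (subcube T s0))
  (cube_polytope #|T|) (face_comb_equiv s0 T3).
by apply/H; apply: cube_has_dim.
Qed.

(** In a smaller dimension some nonzero functional would be constant on the projection, hence
    maximal on all [n >= 4] directions, while [proj_functional] allows at most three. *)
Lemma projected_cube_dim : has_dim projected_cube 4.
Proof.
have pP : is_polytope projected_cube by apply: hull_polytope.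
have ne : projected_cube !=set0.
  by exists (proj_vertex [ffun => true]); apply: hull_vertex; rewrite finset.in_setT.
have [k hk] := polytope_dim pP ne; have [x0 [B [Px0 fB _ PB]]] := hk.
have k4 : (k <= 4)%N by move/eqP: fB => <-; apply: rank_leq_col.
have [e4|n4] := eqVneq k 4%N; first by rewrite e4 in hk.
exfalso; have : cokermx B != 0.
  rewrite -mxrank_eq0 mxrank_coker; move/eqP: fB => ->; lia.
case/matrix0Pn=> i [j cij]; pose c : 'cV[R]_4 := col j (cokermx B).
have c0 : c != 0.
  by apply/matrix0Pn; exists i, 0; rewrite mxE.
have cB y : (y <= B)%MS -> dot c y = 0.
  case/submxP=> D ->; rewrite /dot /c -mulmxA.
  have -> : B *m col j (cokermx B) = 0.
    by rewrite colE mulmxA mulmx_coker mul0mx.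
  by rewrite mulmx0 mxE.
have [b1 [T [s0 [T3 h]]]] := proj_functional c0.
have dP s : dot c (proj_vertex s) = dot c x0.
  apply/eqP; rewrite -subr_eq0 -dotN -dotD; apply/eqP/cB/PB.
  by apply: hull_vertex; rewrite finset.in_setT.
have all_in s : s \in subcube T s0.
  by rewrite -(h s).2 dP -(dP s0) (h s0).2 subcube_refl.
have : T = finset.setT.
  apply/setP => k0; rewrite finset.in_setT -(flip_subcube _ (subcube_refl T s0)).
  exact: all_in.
move=> eT; move: T3; rewrite eT cardsT card_ord /n addn4; lia.
Qed.

(** The zero functional only exposes the whole polytope or the empty face. Any other one is maximal
    on a [subcube] with at most three directions, and nonemptiness of [F] forces [b1] to be this
    maximum. *)
Theorem projected_cube_cubical : cubical_polytope 4 projected_cube.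
Proof.
split; [exact: hull_polytope | exact: projected_cube_dim |].
move=> F fF F0 FP; split; first by apply: face_polytope fF; apply: hull_polytope.
have [c [b1 [cb eF]]] := fF.
have [c0|c0] := eqVneq c 0.
  have z (y : 'rV[R]_4) : (y *m c) 0 0 = 0 by rewrite c0 mulmx0 mxE.
  case: FP; rewrite eF; apply/seteqP; split=> [y []//|y Py]; split=> //.
  by have [y0] := F0; rewrite eF /= !z => -[_ ->].
have [b2 [T [s0 [T3 h]]]] := proj_functional c0.
exists #|T|; suff -> : F = hull proj_vertex (subcube T s0) by apply: face_comb_equiv.
have hb s : s \in [set: signs n]%SET -> dot c (proj_vertex s) <= b2 by move=> _; apply: (h s).1.
have [H1 H2] := hull_max hb.
have -> : subcube T s0 = max_set proj_vertex finset.setT c b2.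
  by apply/setP => s; rewrite [RHS]inE finset.in_setT (h s).2.
rewrite -H2 eF; suff -> : b1 = b2 by [].
have e2 : dot c (proj_vertex s0) = b2 by apply/eqP; rewrite (h s0).2 subcube_refl.
apply/le_anti/andP; split.
  have [y0] := F0; rewrite eF => -[Py <-]; exact: H1.
by rewrite -e2; apply: cb; apply: hull_vertex; rewrite finset.in_setT.
Qed.

(** The hull of a zero-dimensional exposed set is the image of any sign vector in it, so choosing
    one sign vector per set is injective. *)
Lemma projected_cube_vertices : (face_num 0 projected_cube <= 2 ^ n)%N.
Proof.
rewrite (proj1 (face_numE _ _)).
pose f (S : {set signs n}) : signs n := odflt [ffun => true] [pick s in S].
have point S s : S \in dim_sets proj_vertex 0 -> s \in S ->
    hull proj_vertex S = [set proj_vertex s].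
  rewrite inE => /asboolP[_ [y [B [_ _ _ yB]]]] sS.
  have z w : hull proj_vertex S w -> w = y.
    by move=> /yB /submxP [D]; rewrite [D]thinmx0 mul0mx => /eqP; rewrite subr_eq0 => /eqP.
  apply/seteqP; split=> [w /z ->|w ->] /=; last exact: hull_vertex.
  by apply/esym/z/hull_vertex.
have fS S : S \in dim_sets proj_vertex 0 -> f S \in S.
  rewrite inE => /asboolP[_ /has_dim_hull_neq0 /set0Pn [s sS]].
  by rewrite /f; case: pickP => [//|/(_ s)]; rewrite sS.
have fi : {in dim_sets proj_vertex 0 &, injective f}.
  move=> S S' SD SD' eqf; have hS := point S _ SD (fS S SD).
  have := point S' _ SD' (fS S' SD'); rewrite -eqf -hS => hS'.
  move: SD SD'; rewrite !finset.inE => /asboolP[eS _] /asboolP[eS' _].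
  exact: (exposed_hull_inj eS eS' (esym hS')).
rewrite -(card_in_imset fi); apply: leq_trans (max_card _) _.
by rewrite card_ffun card_bool card_ord.
Qed.

Lemma projected_cube_edges : (n * 2 ^ n.-1 <= face_num 1 projected_cube)%N.
Proof.
rewrite (proj1 (face_numE _ _)).
have <- : #|patterns n 1| = (n * 2 ^ n.-1)%N by rewrite card_patterns bin1 subn1.
rewrite -(card_in_imset (@subcube_inj n 1)); apply/subset_leq_card/fintype.subsetP => S.
case/imsetP=> -[T s]; rewrite inE /= => /andP[/cards1P[i eT] _] ->; subst T.
rewrite inE; apply/asboolP; split; last first.
  by have := @face_has_dim [set i]%SET s; rewrite cards1; apply.
have [l [[c lc] li lk]] := edge s i.
have sT s' k : k \notin [set: 'I_n]%SET -> s' k = s k by rewrite finset.in_setT.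
have l0 k : k \in [set: 'I_n]%SET -> 0 <= l 0 k.
  by move=> _; have [->|/lk/ltW//] := eqVneq k i; rewrite li.
exists c^T, ((l *m b) 0 0); split=> [s' _|].
  exact: (proj_certificate lc (sT s') l0).1.
apply/setP => s'; rewrite [RHS]inE finset.in_setT (proj_certificate lc (sT s') l0).2 inE.
apply: eq_forallb => k; rewrite finset.in_setT inE /=.
have [->|ki] := eqVneq k i; first by rewrite li eqxx.
by rewrite (gt_eqF (lk k ki)).
Qed.

End Construction.

(** With [n = N + 4], the bounds [f0 <= 2^n] and [n 2^(n-1) <= f1] turn [4 f3 = 2 f1 - 2 f0] into
    [4 f3 >= n 2^n - 2 f0 >= (n - 2) f0]. *)
Theorem exists_cubical_polytope (R : realType) (N : nat) :
  exists2 P : set 'rV[R]_4, cubical_polytope 4 P &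
    ((N + 2) * face_num 0 P <= 4 * face_num 3 P)%N.
Proof.
have [e [e0 hz he]] := @exists_good_band R N.
have lM := @band_strictly_lower R N.
have [b [x xb]] := exists_sign_vertices e0 lM.
have cP := projected_cube_cubical e0 lM xb hz.
exists (projected_cube x) => //.
have := projected_cube_vertices x; have := projected_cube_edges e0 lM xb hz he.
have := cubical4_face_num cP.
rewrite addn4 /= !expnS; move: (face_num 0 _) (face_num 1 _) (face_num 3 _) => a f c.
move: (2 ^ N)%N => t; nia.
Qed.

(** * The logarithmic formula and the unbounded ratio *)

Section Conclusion.
Context {R : realType}.

Lemma face_of_dim m (P : set 'rV[R]_m) d k : is_polytope P -> has_dim P d ->
  (k <= d)%N -> exists2 F, faces P F & has_dim F k.
Proof.
move=> pP; elim: d P pP => [|d IH] P pP hP.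
  by rewrite leqn0 => /eqP ->; exists P => //; apply: face_refl.
rewrite leq_eqVlt => /predU1P[-> |kd]; first by exists P => //; apply: face_refl.
have [G fG hG] := facet_exists pP hP.
have [F fF hF] := IH G (face_polytope pP fG) hG kd.
by exists F => //; have [] := (facesE F pP fG).1 fF.
Qed.

Lemma face_num_gt0 m (P : set 'rV[R]_m) d k : is_polytope P -> has_dim P d ->
  (k <= d)%N -> (0 < face_num k P)%N.
Proof.
move=> pP hP /(face_of_dim pP hP) [F fF hF].
rewrite cardfs_gt0; apply/fset0Pn; exists F.
by rewrite in_fset_set ?in_setE //; apply: finite_faces.
Qed.

Lemma log2_pow2 n : log2 ((2 ^ n)%:R : R) = n%:R.
Proof.
have l2 : ln 2 != 0 :> R by rewrite gt_eqF // ln_gt0 // ltr1n.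
by rewrite /log2 natrX lnXn // -[_ *+ n]mulr_natl mulfK.
Qed.

End Conclusion.

Unset Implicit Arguments.

Theorem mainTheorem7 (R : realType) :
  (forall (m : nat) (P : set 'rV[R]_m), neighborly_cubical 4 P ->
     (face_num 3 P)%:R
       = (face_num 0 P)%:R / 4 * log2 ((face_num 0 P)%:R / 4 : R) /\
     (forall n : nat, face_num 0 P = (2 ^ n)%N ->
        face_num 3 P = ((n - 2) * 2 ^ (n - 2))%N)) /\
  ~ has_ubound [set r : R | exists (m : nat) (P : set 'rV[R]_m),
      cubical_polytope 4 P /\ r = (face_num 3 P)%:R / (face_num 0 P)%:R].
Proof.
split=> [m P nP|[B Bub]].
  split=> [|n /(neighborly_face_num nP) [] //].
  have [_ [n [_ f0 _]]] := nP; have [n4 ->] := neighborly_face_num nP f0.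
  have -> : (face_num 0 P)%:R / 4 = (2 ^ (n - 2))%:R :> R.
    have -> : face_num 0 P = (2 ^ (n - 2) * 4)%N.
      by rewrite f0 -[4%N]/(2 ^ 2)%N -expnD subnK // (leq_trans _ n4).
    by rewrite natrM mulfK // pnatr_eq0.
  by rewrite log2_pow2 natrM mulrC.
(* This choice gives [4 B < N], while the ratio of the polytope below is at least [(N + 2) / 4]. *)
pose N := Num.Def.archi_bound (4 * `|B|).
have [P cP] := exists_cubical_polytope R N; have [pP hP _] := cP.
have f0 := face_num_gt0 pP hP (isT : 0 <= 4)%N.
have : (face_num 3 P)%:R / (face_num 0 P)%:R <= B.
  by apply: Bub; exists 4%N, P.
rewrite ler_pdivrMr ?ltr0n // => le1; rewrite -(ler_nat R) !natrM natrD => le2.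
have NB : 4 * B < N%:R.
  apply: le_lt_trans (archi_boundP _); last by rewrite mulr_ge0.
  by rewrite ler_pM2l ?ler_norm.
have : (4 * B) * (face_num 0 P)%:R < (N%:R + 2) * (face_num 0 P)%:R.
  by rewrite ltr_pM2r ?ltr0n //; lra.
move: le1 le2; move: (face_num 0 P)%:R (face_num 3 P)%:R => a c; lra.
Qed.
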